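(* Let $(X,F,D)$ be a dislocation space. If $(u_k)_{k\in\mathbb N}\subset X$ is a bounded sequence, then there exist a set $\mathbb N_0\subset\mathbb N$, elements $w^{(n)}\in X$ and sequences $(g_k^{(n)})_{k\in\mathbb N}\subset D$, $n\in\mathbb N_0$, with $g_k^{(1)}=\mathrm{id}$ for all $k$ (if $1\in\mathbb N_0$) and $$(g_k^{(m)})^{-1}g_k^{(n)}\rightharpoonup 0\quad\text{as }k\to\infty,\qquad m\neq n,\ m,n\in\mathbb N_0,$$ such that for a renumbered subsequence of $(u_k)$ (still denoted $(u_k)$): (i) for every $n\in\mathbb N_0$, $w^{(n)}$ is the weak limit of $(g_k^{(n)})^{-1}u_k$ as $k\to\infty$; (ii) $\sum_{n\in\mathbb N_0}F(w^{(n)})\le\limsup_{k\to\infty}F(u_k)$; (iii) $u_k-\sum_{n\in\mathbb N_0}g_k^{(n)}w^{(n)}$ converges $D$-weakly to $0$ as $k\to\infty$, where the series $\sum_{n\in\mathbb N_0}g_k^{(n)}w^{(n)}$ converges uniformly in $k$ in the sense that $$\sup_{k\in\mathbb N}F\Big(\sum_{n\in\mathbb N_0,\ n\ge m}g_k^{(n)}w^{(n)}\Big)\to0\quad\text{as }m\to\infty.$$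
   Context: Vector spaces are real. $\rightharpoonup$ denotes weak convergence in $X$. For a sequence of linear operators $g_k$ on $X$, $g_k\rightharpoonup0$ means $g_ku\rightharpoonup0$ for every $u\in X$, and $g_k\not\rightharpoonup0$ is the negation of this. Dislocation space: a triple $(X,F,D)$ such that (1) $X$ is a vector space and $F:X\to[0,\infty)$ is even, convex, $C^2$ (on each finite-dimensional subspace), with $F^{-1}(0)=\{0\}$; $X$ is equipped with the norm $\|u\|=\inf\{\lambda>0:F(\lambda^{-1}u)\le1\}$; (2) with this norm $X$ is a separable reflexive Banach space, and $F$ is continuous on $X$ and uniformly continuous on bounded sets; (3) $D$ is a group of linear operators on $X$, closed with respect to strong (elementwise) convergence, with $F\circ g=F$ for all $g\in D$; (4) if $g_k\in D$, $g_k\not\rightharpoonup0$ and $u_k\rightharpoonup0$, then $g_ku_k\rightharpoonup0$ on a subsequence; (5) whenever $M\in\mathbb N$, sequences $(g_k^{(n)})_{k}\subset D$, $n=1,\dots,M$, satisfy $(g_k^{(m)})^{-1}g_k^{(n)}\rightharpoonup0$ for $m\ne n$, and $(u_k)\subset X$ is a bounded sequence with $(g_k^{(n)})^{-1}u_k\rightharpoonup w^{(n)}$, $n=1,\dots,M$, then $\liminf_kF(u_k)\ge\sum_{n=1}^MF(w^{(n)})$ and $F\big(\sum_{n=1}^Mg_k^{(n)}w^{(n)}\big)\to\sum_{n=1}^MF(w^{(n)})$. $D$-weak convergence: $u_k\in X$ converges $D$-weakly to $u\in X$ if $g_k(u_k-u)\rightharpoonup0$ for every sequence $g_k\in D$.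 *)

(* Defs.v *)
From HB Require Import structures.
From mathcomp Require Import all_boot all_order all_algebra.
From mathcomp Require Import all_classical all_reals all_analysis.

Set Implicit Arguments.
Unset Strict Implicit.
Unset Printing Implicit Defensive.

Import Order.TTheory GRing.Theory Num.Theory.
Import numFieldNormedType.Exports.

Local Open Scope classical_set_scope.
Local Open Scope ring_scope.

Definition dual_space (R : realType) (X : normedModType R) : set (X -> R^o) :=
  [set f | linear f /\ continuous f].

Definition dual_norm (R : realType) (X : normedModType R) (f : X -> R^o) : R :=
  sup [set `|f x| | x in [set x : X | `|x| <= 1]].

(* Every bounded linear functional on the normed dual is an evaluation; such a
   functional is a map [Phi] whose values outside [dual_space] are irrelevant. *)
Definition reflexive_space (R : realType) (X : normedModType R) : Prop :=
  forall Phi : (X -> R^o) -> R,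
    (forall (a : R) (f h : X -> R^o), dual_space f -> dual_space h ->
       Phi (a *: f + h) = a * Phi f + Phi h) ->
    (exists C : R, forall f, dual_space f -> `|Phi f| <= C * dual_norm f) ->
    exists x : X, forall f, dual_space f -> Phi f = f x.

Definition separable_space (T : topologicalType) : Prop :=
  exists2 S : set T, countable S & dense S.

Definition wcvg (R : realType) (X : normedModType R)
    (u : nat -> X) (l : X) : Prop :=
  forall f : X -> R^o, dual_space f -> (fun k => f (u k)) @ \oo --> f l.

Definition op_wcvg0 (R : realType) (X : normedModType R)
    (g : nat -> X -> X) : Prop :=
  forall u : X, wcvg (fun k => g k u) 0.

Definition Dwcvg (R : realType) (X : normedModType R) (D : set (X -> X))
    (u : nat -> X) (l : X) : Prop :=
  forall g : nat -> X -> X, (forall k, D (g k)) ->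
    wcvg (fun k => g k (u k - l)) 0.

(* The inverse of a bijective operator; unspecified on other arguments. *)
Definition opinv (R : realType) (X : normedModType R) (g : X -> X) : X -> X :=
  pinv [set: X] g.

Definition C2 (R : realType) (n : nat) (f : 'rV[R]_n -> R^o) : Prop :=
  let e (i : 'I_n) : 'rV[R]_n := delta_mx 0 i in
  [/\ continuous f,
      forall i, (forall x, derivable f x (e i)) /\ continuous ('D_(e i) f) &
      forall i j, (forall x, derivable ('D_(e i) f) x (e j)) /\
                  continuous ('D_(e j) ('D_(e i) f))].

(* The set [D] is taken as a set of bare functions, required to be linear and
   to form a group under composition.  The norm of [X] is tied to [F] by
   [ds_norm]; completeness is part of the type of [X]. *)
Record dislocation_space (R : realType) (X : completeNormedModType R)
    (F : X -> R) (D : set (X -> X)) : Prop := DislocationSpace {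
  ds_ge0 : forall u, 0 <= F u ;
  ds_even : forall u, F (- u) = F u ;
  ds_convex : convex_function (E := X) setT F ;
  (* injective linear maps from R^n are the linear coordinate systems of the
     finite-dimensional subspaces *)
  ds_C2 : forall (n : nat) (L : {linear 'rV[R]_n -> X}),
    injective L -> C2 (fun a => F (L a)) ;
  ds_zero : F @^-1` [set 0] = [set 0] ;
  ds_norm : forall u : X,
    `|u| = inf [set lam : R | 0 < lam /\ F (lam^-1 *: u) <= 1] ;

  ds_separable : separable_space X ;
  ds_reflexive : reflexive_space X ;
  ds_continuous : continuous F ;
  ds_unif_continuous : forall A : set X, bounded_set A ->
    forall eps : R, 0 < eps -> exists2 delta : R, 0 < delta &
      forall u v, A u -> A v -> `|u - v| < delta -> `|F u - F v| < eps ;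

  ds_linear : forall g, D g -> linear g ;
  ds_id : D idfun ;
  ds_comp : forall g h, D g -> D h -> D (g \o h) ;
  ds_inv : forall g, D g -> bijective g /\ D (opinv g) ;
  ds_closed : forall (g : nat -> X -> X) (h : X -> X), (forall k, D (g k)) ->
    (forall u, (fun k => g k u) @ \oo --> h u) -> D h ;
  ds_invariant : forall g, D g -> F \o g = F ;

  ds_subsequence : forall (g : nat -> X -> X) (u : nat -> X),
    (forall k, D (g k)) -> ~ op_wcvg0 g -> wcvg u 0 ->
    exists2 phi : nat -> nat, increasing_seq phi &
      wcvg (fun k => g (phi k) (u (phi k))) 0 ;

  ds_splitting : forall (M : nat) (g : 'I_M -> nat -> X -> X)
      (u : nat -> X) (w : 'I_M -> X),
    (forall n k, D (g n k)) ->
    (forall m n, m != n -> op_wcvg0 (fun k => opinv (g m k) \o g n k)) ->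
    bounded_fun u ->
    (forall n, wcvg (fun k => opinv (g n k) (u k)) (w n)) ->
    ((\sum_(n < M) F (w n))%:E <= limn_einf (fun k => (F (u k))%:E))%E /\
    (fun k => F (\sum_(n < M) g n k (w n))) @ \oo --> \sum_(n < M) F (w n)
}.

Definition profile_psum (R : realType) (X : completeNormedModType R)
    (N0 : set nat) (w : nat -> X) (g : nat -> nat -> X -> X)
    (m k : nat) : nat -> X :=
  fun N => \sum_(m <= n < N | n \in N0) g n k (w n).

(* The norm limit of the partial sums, i.e. the sum over n in N0 with
   n >= m; meaningful when the partial sums converge. *)
Definition profile_tail (R : realType) (X : completeNormedModType R)
    (N0 : set nat) (w : nat -> X) (g : nat -> nat -> X -> X)
    (m k : nat) : X :=
  limn (profile_psum N0 w g m k).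

(* Main.v *)
Require Import Defs.
From HB Require Import structures.
From mathcomp Require Import all_boot all_order all_algebra.
From mathcomp Require Import all_classical all_reals all_analysis.
From mathcomp Require Import ring lra.

Import Order.TTheory GRing.Theory Num.Theory.
Import numFieldNormedType.Exports.

Local Open Scope classical_set_scope.
Local Open Scope ring_scope.

(** The proof runs along an ultrafilter [U] finer than the Frechet filter. In a
    reflexive space every bounded sequence has a weak limit along [U]
    ([ultra_weak_limit]), so profiles can be chosen without passing to
    subsequences, and a single subsequence is extracted at the end.

    Extraction needs countably many conditions. The derivatives of the convex
    function [F] at a dense sequence of points form a countable family of
    functionals separating points ([separating_family]); by reflexivity such a
    family tests the weak convergence of bounded sequences
    ([wcvg_separating]). Hence [ds_subsequence] and [ds_splitting] have versions
    along [U] ([ultra_dislocation], [ultra_splitting_sum],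
    [ultra_splitting_le]).

    Profiles are chosen greedily: [w 0] is the weak limit of [u], and [w n] is a
    weak limit of a dislocation of the remainder
    [u k - \sum_(i < n) g i k (w i)] whose value under [F] is maximal up to a
    factor 2 and a truncation. The dislocation sequences of distinct profiles are
    asymptotically orthogonal, so the values [F (w n)] have a finite sum
    ([profile_system_exists], [profile_sum_bounded]).

    If some profile after the first vanishes, all sums are finite. If none does,
    there are arbitrarily many orthogonal dislocations, and this forces [F x] to
    control the norm near zero ([F_coercive]). Moreover, the dislocations can be
    changed for a [U]-null set of indices [k], for each [n], so that for all [k]
    the value of [F] at [\sum_(m <= i < n) g i k (w i)] is at most
    [\sum_(m <= i < n) (F (w i) + 2^-1 ^+ i)]
    ([modified_dislocations]). The profile series then converges in norm,
    uniformly in [k] ([uniform_profiles]). By maximality the dislocated weak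
    limits of the remainders tend to zero, so the total remainder is uniformly
    small under all dislocations, when tested on any functional
    ([remainder_Dnull]). *)

(** * Linear functionals and weak limits along filters *)

Section WeakLimits.
Context {R : realType} {X : completeNormedModType R}.
Implicit Types (f : X -> R^o) (v : nat -> X) (x y l : X).

Lemma dual_linP {f} : dual_space f -> exists h : {linear X -> R^o}, f = h.
Proof.
case=> fL _.
pose A := GRing.isLinear.Build R X R^o *:%R f fL.
pose h : {linear X -> R^o} := HB.pack f A.
by exists h.
Qed.

Lemma dual_bounded {f} : dual_space f ->
  exists2 C : R, 0 < C & forall x, `|f x| <= C * `|x|.
Proof.
move=> fD; have [h fh] := dual_linP fD; case: fD => _; rewrite fh => fc.
have /linear_boundedP := iffRL (linear_bounded_continuous h) fc.
case=> M [Mr hM]; exists (Num.max M 0 + 1).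
  by rewrite ltr_pwDr// le_max lexx orbT.
by apply: hM; rewrite ltr_pwDr// le_max lexx.
Qed.

Lemma dual_spaceP f : linear f ->
  (exists C : R, forall x, `|f x| <= C * `|x|) -> dual_space f.
Proof.
move=> fL [C fC]; split => //.
pose A := GRing.isLinear.Build R X R^o *:%R f fL.
pose h : {linear X -> R^o} := HB.pack f A.
apply: (iffLR (linear_bounded_continuous h)); apply/linear_boundedP.
exists C; split=> [|r Cr x]; first exact: num_real.
by apply: le_trans (fC x) _; apply: ler_wpM2r => //; exact: ltW.
Qed.

Lemma dual_add f h : dual_space f -> dual_space h -> dual_space (f + h).
Proof.
move=> [fL fc] [hL hc]; split.
  move=> a x y; rewrite /= !fctE fL hL scalerDr.
  by rewrite addrACA.
by move=> x; apply: cvgD; [exact: fc | exact: hc].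
Qed.

Lemma le_dual_norm f x : dual_space f -> `|f x| <= dual_norm f * `|x|.
Proof.
move=> fD; have [C C0 hC] := dual_bounded fD.
have [h fh] := dual_linP fD.
have ub y : `|y| <= 1 -> `|f y| <= dual_norm f.
  move=> y1; apply: ub_le_sup; last by exists y.
  exists C => _ [z /= z1 <-]; apply: le_trans (hC z) _.
  by rewrite ler_piMr// ltW.
have [->|x0] := eqVneq x 0; first by rewrite fh linear0 !normr0 mulr0.
have nx : 0 < `|x| by rewrite normr_gt0.
rewrite -ler_pdivrMr//; have := ub (`|x|^-1 *: x).
rewrite fh linearZ /= normrZ normfV normr_id mulVf ?gt_eqF// => /(_ (lexx _)).
by rewrite -fh [X in X <= _ -> _]normrM normfV normr_id mulrC.
Qed.

Lemma dual_norm_ge0 f : 0 <= dual_norm f.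
Proof.
rewrite /dual_norm; set S := (S in sup S).
have [hs|/sup_out -> //] := pselect (has_sup S).
apply: le_trans (normr_ge0 (f 0)) _; apply: (sup_upper_bound hs).
by exists 0 => //=; rewrite normr0.
Qed.

(** Weak convergence of a sequence along an arbitrary filter on the indices;
    for the Frechet filter it is [wcvg]. *)
Definition wcvg_along (G : set_system nat) v l :=
  forall f, dual_space f -> f (v k) @[k --> G] --> (f l : R^o).

Lemma eq_wcvg_along (G : set_system nat) v v' l l' : v =1 v' -> l = l' ->
  wcvg_along G v l -> wcvg_along G v' l'.
Proof. by move=> /funext -> ->. Qed.

Lemma near_eq_wcvg_along (G : set_system nat) {FG : Filter G} v v' l :
  (\forall k \near G, v' k = v k) -> wcvg_along G v l -> wcvg_along G v' l.
Proof.
move=> vv' vl f fD; apply: cvg_trans (vl f fD); apply: near_eq_cvg.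
by apply: filterS vv' => k ->.
Qed.

Lemma wcvg_alongD (G : set_system nat) {FG : Filter G} v v' l l' :
  wcvg_along G v l -> wcvg_along G v' l' ->
  wcvg_along G (fun k => v k + v' k) (l + l').
Proof.
move=> h h' f fD; have [g e] := dual_linP fD; rewrite e linearD.
under eq_fun do rewrite linearD.
by rewrite -e; apply: cvgD; [exact: h | exact: h'].
Qed.

Lemma wcvg_alongB (G : set_system nat) {FG : Filter G} v v' l l' :
  wcvg_along G v l -> wcvg_along G v' l' ->
  wcvg_along G (fun k => v k - v' k) (l - l').
Proof.
move=> h h' f fD; have [g e] := dual_linP fD; rewrite e linearB.
under eq_fun do rewrite linearB.
by rewrite -e; apply: cvgB; [exact: h | exact: h'].
Qed.

Lemma wcvg_along_cst (G : set_system nat) {FG : Filter G} l :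
  wcvg_along G (fun=> l) l.
Proof. by move=> f _; exact: cvg_cst. Qed.

End WeakLimits.

Section UltraLimits.
Context {R : realType} {X : completeNormedModType R}.
Context {U : set_system nat} {UU : UltraFilter U}.

Let UP : ProperFilter U := ultra_proper.
Local Existing Instance UP.

Lemma ultra_cvg_real (a : nat -> R) (C : R) :
  (forall k, `|a k| <= C) -> exists l : R, a k @[k --> U] --> l.
Proof.
move=> aC; have aCU : (a @ U) `[- C, C]%classic.
  by apply: (@filterS _ U _ setT); [move=> k _; rewrite /= in_itv /= -ler_norml|exact: filterT].
have [l [_ hl]] := segment_compact (fmap_proper_filter a UP) aCU.
exists l => B nB; have [//|UB] := in_ultra_setVsetC (a @^-1` B) UU.
by have [x [nBx Bx]] := hl (~` B) B UB nB.
Qed.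

(** In a reflexive space the limits of [f (v k)] along an ultrafilter depend on
    [f] as a bounded functional on the dual, hence are given by a vector. *)
Lemma ultra_weak_limit (Xrefl : reflexive_space X) (v : nat -> X) (C : R) :
  (forall k, `|v k| <= C) -> exists l, wcvg_along U v l.
Proof.
move=> vC.
have ex (f : X -> R^o) : exists l : R, dual_space f -> f (v k) @[k --> U] --> l.
  have [fD|] := pselect (dual_space f); last by exists 0.
  have [K K0 hK] := dual_bounded fD.
  have [|l hl] := @ultra_cvg_real (f \o v) (K * C); last by exists l.
  by move=> k /=; apply: le_trans (hK _) _; rewrite ler_pM2l.
have [Phi hPhi] := choice ex.
have [||x hx] := Xrefl Phi.
- move=> a f h fD hD.
  have afD : dual_space (a *: f).
    case: fD => fL fc; split => [b x y|x].
      by rewrite /= !fctE fL scalerDr !scalerA mulrC.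
    by apply: cvgZr; exact: fc.
  have h1 := hPhi _ (dual_add _ _ afD hD).
  have h2 : (a *: f + h) (v k) @[k --> U] --> a * Phi f + Phi h.
    by apply: cvgD; [apply: cvgMr; exact: hPhi | exact: hPhi].
  exact: (cvg_unique _ h1 h2).
- exists C => f fD.
  have h : `|f (v k)| @[k --> U] --> `|Phi f| by apply: cvg_norm; exact: hPhi.
  apply: (cvgr_to_le h); apply: filterE => k.
  apply: le_trans (le_dual_norm _ _ fD) _; rewrite mulrC.
  by apply: ler_wpM2r => //; rewrite /dual_norm; apply: dual_norm_ge0.
- by exists x => f fD; rewrite -hx//; exact: hPhi.
Qed.

End UltraLimits.

(** * A countable separating family of functionals *)

Section Separation.
Context {R : realType} {X : completeNormedModType R}.
Context {F : X -> R} {D : set (X -> X)} (hD : dislocation_space F D).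
Implicit Types (x y v w : X).

Lemma F0 : F 0 = 0.
Proof. by have : (F @^-1` [set 0]) 0 by rewrite (ds_zero hD). Qed.

Lemma F_eq0 x : F x = 0 -> x = 0.
Proof. by move=> Fx; have : (F @^-1` [set 0]) x by []; rewrite (ds_zero hD). Qed.

Lemma F_gt0 x : x != 0 -> 0 < F x.
Proof.
move=> x0; rewrite lt_neqAle (ds_ge0 hD) andbT eq_sym.
by apply: contra_neq x0; exact: F_eq0.
Qed.

(* The scalar is packed as an element of the unit interval type over which
   [convex_function] quantifies. *)
Lemma F_convex (t : R) x y : 0 <= t <= 1 ->
  F (t *: x + (1 - t) *: y) <= t * F x + (1 - t) * F y.
Proof.
move=> t01.
have ti : Itv.spec (@Itv.num_sem R) (Itv.Real `[0%Z, 1%Z]) t.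
  by rewrite /= /Itv.num_sem/= num_real /= in_itv/= /(0%:~R) t01.
pose T : {i01 R} := Itv.mk ti.
exact: (ds_convex hD T (mem_setT x) (mem_setT y)).
Qed.

(** [gateaux x v l]: the derivative of [F] at [x] in the direction [v] is [l]. *)
Definition gateaux x v (l : R) := forall e : R, 0 < e ->
  \forall h \near (0 : R), `|F (x + h *: v) - F x - h * l| <= e * `|h|.

Lemma gateaux_derivable (n : nat) (L : {linear 'rV[R]_n -> X}) (a b : 'rV[R]_n) :
  derivable ((fun a => F (L a)) : 'rV[R]_n -> R^o) a b ->
  exists l, gateaux (L a) (L b) l.
Proof.
move=> /cvg_ex[l hl]; exists l => e e0.
have /cvgrPdist_le/(_ e e0) := hl.
rewrite /dnbhs near_withinE; apply: filterS => h.
have [->|h0] := eqVneq h 0; first by move=> _; rewrite scale0r addr0 subrr mul0r subrr normr0 mulr0.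
have eL : L (h *: b + a) = L a + h *: L b by rewrite linearD linearZ addrC.
move=> /(_ isT); rewrite /= eL.
have -> : F (L a + h *: L b) - F (L a) - h * l =
   - h * (l - h^-1 * (F (L a + h *: L b) - F (L a))) by field.
by rewrite normrM normrN mulrC; exact: ler_wpM2r.
Qed.

(** [ds_C2] applies to the line spanned by [v] or to the plane spanned by [x]
    and [v], according to whether [x] is a multiple of [v]. *)
Lemma gateaux_exists x v : exists l, gateaux x v l.
Proof.
have [->|v0] := eqVneq v 0.
  exists 0 => e e0; near=> h.
  by rewrite scaler0 addr0 subrr mulr0 subrr normr0 mulr_ge0// ltW.
have [[c ->]|nx] := pselect (exists c, x = c *: v).
  pose Lf (a : 'rV[R]_1) := a 0 0 *: v.
  have LfL : linear Lf by move=> t a b; rewrite /Lf !mxE scalerDl scalerA.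
  pose A := GRing.isLinear.Build R 'rV[R]_1 X *:%R Lf LfL.
  pose L : {linear 'rV[R]_1 -> X} := HB.pack Lf A.
  have Li : injective L.
    move=> a b /= /eqP; rewrite /Lf -subr_eq0 -scalerBl scaler_eq0 (negbTE v0) orbF.
    rewrite subr_eq0 => /eqP ab; apply/rowP => i; by rewrite ord1.
  have [_ dL _] := ds_C2 hD Li.
  have [l] := gateaux_derivable _ L _ _ ((dL 0).1 (const_mx c)).
  by rewrite /= /Lf !mxE -[(_ && _)]/true scale1r; exists l.
pose Lf (a : 'rV[R]_2) := a 0 0 *: x + a 0 1 *: v.
have LfL : linear Lf.
  by move=> t a b; rewrite /Lf !mxE !scalerDl !scalerDr !scalerA addrACA.
pose A := GRing.isLinear.Build R 'rV[R]_2 X *:%R Lf LfL.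
pose L : {linear 'rV[R]_2 -> X} := HB.pack Lf A.
have Li : injective L.
  apply: raddf_inj => a /= /eqP; rewrite /Lf addr_eq0 -scaleNr => /eqP e.
  have a0 : a 0 0 = 0.
    apply/eqP/negPn/negP => a0; apply: nx; exists ((a 0 0)^-1 * - a 0 1).
    by rewrite -scalerA -e scalerA mulVf// scale1r.
  have a1 : a 0 1 = 0.
    move: e; rewrite a0 scale0r => /esym/eqP; rewrite scaler_eq0 (negbTE v0) orbF.
    by rewrite oppr_eq0 => /eqP.
  apply/rowP => i; rewrite mxE; case: i => [[|[|//]] hi].
    by rewrite -[RHS]a0; congr (a _ _); apply: val_inj.
  by rewrite -[RHS]a1; congr (a _ _); apply: val_inj.
have [_ dL _] := ds_C2 hD Li.
have [l] := gateaux_derivable _ L _ _ ((dL 1).1 (delta_mx 0 0)).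
by rewrite /= /Lf !mxE /= !scale1r !scale0r addr0 add0r; exists l.
Unshelve. all: by end_near. Qed.

(** The subgradient inequality. *)
Lemma gateaux_le x v l : gateaux x v l -> F x + l <= F (x + v).
Proof.
move=> hl; apply/ler_addgt0Pr => e e0.
have /nbhs_ballP[d /= d0 hd] := hl e e0.
pose h := Num.min (d / 2) 1.
have h0 : 0 < h by rewrite lt_min ltr01 andbT divr_gt0.
have hd' : h < d by rewrite gt_min ltr_pdivrMr// ltr_pMr// ltr1n.
have h1 : 0 <= h <= 1 by rewrite ltW//= ge_min lexx orbT.
have /hd : ball (0 : R) d h by rewrite /ball /= sub0r normrN gtr0_norm.
rewrite ler_norml (gtr0_norm h0) => /andP[hl1 _].
have := F_convex h (x + v) x h1.
have -> : h *: (x + v) + (1 - h) *: x = x + h *: v.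
  by rewrite scalerDr scalerBl scale1r addrC addrA subrK.
move=> hc; rewrite -(ler_pM2l h0); nra.
Qed.

Lemma gateauxZ x v l c : gateaux x v l -> gateaux x (c *: v) (c * l).
Proof.
move=> hl e e0.
have e0' : 0 < e / (`|c| + 1) by rewrite divr_gt0// ltr_wpDl.
have lim : (fun h : R => c * h) @ (0 : R) --> (0 : R).
  by rewrite -[X in _ --> X](mulr0 c); apply: cvgMr; exact: cvg_id.
have h2 : \forall h \near (0 : R), `|F (x + (c * h) *: v) - F x - (c * h) * l|
    <= e / (`|c| + 1) * `|c * h| := lim _ (hl _ e0').
apply: filterS h2 => h; rewrite scalerA mulrA [h * c]mulrC.
move=> /le_trans; apply; rewrite normrM mulrA.
apply: ler_wpM2r => //; rewrite mulrAC ler_pdivrMr ?ltr_wpDl//.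
by rewrite ler_pM2l// lerDl.
Qed.

(** Directional derivatives of a convex function are subadditive, being limits
    of increments at the midpoint [x + h *: (u + v)] of [x + h *: (2 *: u)] and
    [x + h *: (2 *: v)]. The increment [h] may have both signs, whence
    equality. *)
Lemma gateauxD x u v w l m n : u + v = w ->
  gateaux x u l -> gateaux x v m -> gateaux x w n ->
  n = l + m.
Proof.
move=> <- hl hm hn.
have hl2 := gateauxZ _ _ _ 2 hl; have hm2 := gateauxZ _ _ _ 2 hm.
have key e : 0 < e -> exists2 d : R, 0 < d & forall h, `|h| < d ->
    h * n <= h * (l + m) + e * `|h|.
  move=> e0; have e2 : 0 < e / 2 by rewrite divr_gt0.
  have : \forall h \near (0 : R), h * n <= h * (l + m) + e * `|h|.
    near=> h.
    have := F_convex 2^-1 (x + h *: (2 *: u)) (x + h *: (2 *: v)).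
    have -> : 1 - 2^-1 = 2^-1 :> R by field.
    have sc z : 2^-1 *: (x + h *: (2 *: z)) = 2^-1 *: x + h *: z.
      by rewrite scalerDr !scalerA; congr (_ + _ *: _); field.
    rewrite !sc addrACA -scalerDl -scalerDr.
    have -> : 2^-1 + 2^-1 = 1 :> R by field.
    rewrite scale1r.
    have half01 : 0 <= (2^-1 : R) <= 1 by apply/andP; split; lra.
    move=> /(_ half01) hc.
    have : `|F (x + h *: (2 *: u)) - F x - h * (2 * l)| <= e / 2 * `|h| by near: h; exact: hl2.
    have : `|F (x + h *: (2 *: v)) - F x - h * (2 * m)| <= e / 2 * `|h| by near: h; exact: hm2.
    have : `|F (x + h *: (u + v)) - F x - h * n| <= e / 2 * `|h| by near: h; exact: hn.
    rewrite !ler_norml => /andP[a1 a2] /andP[b1 b2] /andP[c1 c2].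
    lra.
  by move=> /nbhs_ballP[d /= d0 hd]; exists d => // h hh; apply: hd; rewrite /ball /= sub0r normrN.
apply/eqP; rewrite eq_le; apply/andP; split; apply/ler_addgt0Pr => e e0.
  have [d d0 hd] := key e e0; have c0 : 0 < d / 2 by rewrite divr_gt0.
  have := hd (d / 2); rewrite gtr0_norm// ltr_pdivrMr// ltr_pMr// ltr1n => /(_ isT) hc.
  by rewrite -(ler_pM2l c0); lra.
have [d d0 hd] := key e e0; have c0 : 0 < d / 2 by rewrite divr_gt0.
have := hd (- (d / 2)); rewrite normrN gtr0_norm// ltr_pdivrMr// ltr_pMr// ltr1n => /(_ isT) hc.
by rewrite -(ler_pM2l c0); lra.
Unshelve. all: by end_near. Qed.

(** The derivative is bounded because [F] is bounded above near [x]. *)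
Lemma gateaux_dual x (f : X -> R^o) : (forall v, gateaux x v (f v)) -> dual_space f.
Proof.
move=> hf.
have fL : linear f.
  move=> a u v; apply: (gateauxD x (a *: u) v (a *: u + v)) => //.
  by apply: gateauxZ; exact: hf.
have f0 : f 0 = 0.
  by have := fL (-1) 0 0; rewrite scaler0 addr0 scaleN1r addNr.
have fZ c v : f (c *: v) = c * f v by have := fL c v 0; rewrite !addr0 f0 addr0.
have [r /= r0 hr] : exists2 r : R, 0 < r & forall v, `|v| < r -> F (x + v) <= F x + 1.
  have cF : F z @[z --> x] --> F x by exact: ds_continuous hD x.
  have : \forall z \near x, F z <= F x + 1 by apply: (cvgr_le _ cF); rewrite ltrDl.
  move=> /nbhs_ballP[r /= r0 hr]; exists r => // v vr.
  by apply: hr; rewrite -ball_normE /= opprD addNKr normrN.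
have ub v : `|v| < r -> f v <= 1.
  by move=> vr; have := gateaux_le _ _ _ (hf v); have := hr v vr; lra.
apply: dual_spaceP => //; exists (2 / r) => v.
have [->|v0] := eqVneq v 0; first by rewrite f0 !normr0 mulr0.
have nv : 0 < `|v| by rewrite normr_gt0.
pose c := r / 2 / `|v|.
have c0 : 0 < c by rewrite !divr_gt0.
have hc : `|c *: v| < r.
  by rewrite normrZ gtr0_norm// divfK ?gt_eqF// ltr_pdivrMr// ltr_pMr// ltr1n.
have u1 := ub _ hc; have := ub (- (c *: v)); rewrite normrN => /(_ hc).
rewrite -scaleNr fZ => u2; rewrite fZ in u1.
have -> : 2 / r * `|v| = c^-1 by rewrite /c !invfM !invrK; field; rewrite !gt_eqF.
by rewrite -(ler_pM2l c0) divff ?gt_eqF// -[c in X in X <= _](gtr0_norm c0) -normrM ler_norml; lra.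
Qed.

Lemma dense_sequence : exists c : nat -> X,
  forall x (e : R), 0 < e -> exists i, `|x - c i| < e.
Proof.
have [S Sc Sd] := ds_separable hD.
have [c cS] : exists c : nat -> X, S `<=` range c.
  have /countable_injP[j ji] := Sc.
  have /choice[c hc] : forall n, exists x, forall y, S y -> j y = n -> x = y.
    move=> n; have [[y [Sy <-]]|no] := pselect (exists y, S y /\ j y = n).
      by exists y => z Sz jz; apply: ji; rewrite ?inE.
    by exists 0 => y Sy jy; case: no; exists y.
  by exists c => y Sy; exists (j y) => //; exact: hc.
exists c => x e e0.
have [y [yr /cS[i _ ciy]]] : ball x e `&` S !=set0.
  by apply: Sd; [exists x; exact: ballxx | exact: ball_open].
by exists i; rewrite ciy; move: yr; rewrite -ball_normE.
Qed.

(** The derivatives of [F] at the points of a dense sequence separate points: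
    if [f] is the derivative at [y] and [f x = 0] then [F (y - x) >= F y] by the
    subgradient inequality, which fails for [y] close to [x] when [x != 0]. *)
Lemma separating_family : exists2 f : nat -> X -> R^o,
  (forall i, dual_space (f i)) & forall x, (forall i, f i x = 0) -> x = 0.
Proof.
have [c cd] := dense_sequence.
have [L hL] : exists L : X -> X -> R^o, forall x v, gateaux x v (L x v).
  have ex x : exists f : X -> R^o, forall v, gateaux x v (f v).
    by have [f hf] := choice (gateaux_exists x); exists f.
  by have [L hL] := choice ex; exists L.
exists (L \o c) => [i|x Lx0]; first exact: gateaux_dual (hL _).
apply: contrapT => /eqP x0; have Fx := F_gt0 _ x0.
have F2 : 0 < F x / 2 by rewrite divr_gt0.
have cF y : F z @[z --> y] --> F y by exact: ds_continuous hD y.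
have n1 : \forall y \near x, F x / 2 < F y.
  by apply: (cvgr_gt _ (cF x)); rewrite ltr_pdivrMr// ltr_pMr// ltr1n.
have n2 : \forall y \near x, F (y - x) < F x / 2.
  have lim : F (y - x) @[y --> x] --> F 0.
    have l1 : y - x @[y --> x] --> (0 : X).
      by rewrite -[X in _ --> X](subrr x); apply: cvgB; [exact: cvg_id | exact: cvg_cst].
    exact: cvg_comp l1 (cF 0).
  by apply: (cvgr_lt _ lim); rewrite F0.
have /nbhs_ballP[r /= r0 hr] :
  \forall y \near x, F x / 2 < F y /\ F (y - x) < F x / 2 by exact: filterI.
have [i xci] := cd x r r0.
have [] := hr (c i); first by rewrite -ball_normE.
move=> h1 h2.
have := gateaux_le _ _ _ (hL (c i) (- x)).
have /dual_linP[h e] := gateaux_dual _ _ (hL (c i)).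
by rewrite e linearN -e [L _ _]Lx0 oppr0 addr0; lra.
Qed.

End Separation.

(** * Extracting subsequences from an ultrafilter *)

Section UltraSubsequences.
Context {U : set_system nat} {UU : UltraFilter U} (Uoo : \oo `<=` U).

Let UP : ProperFilter U := ultra_proper.
Local Existing Instance UP.

(** A diagonal sequence through countably many sets of the ultrafilter. *)
Lemma ultra_subsequence (I : countType) (A : I -> set nat) :
  (forall i, U (A i)) ->
  exists2 phi : nat -> nat, increasing_seq phi &
    forall i, \forall j \near \oo, A i (phi j).
Proof.
move=> UA.
(* [B] enumerates the sets [A i]; it is the full set at the other integers. *)
pose B n := if unpickle n is Some i then A i else setT.
have UB n : U (B n) by rewrite /B; case: unpickle => [i|]; [exact: UA | exact: filterT].
have nextP (p : nat * nat) : exists n, (p.2 < n)%N /\ forall j, (j <= p.1)%N -> B j n.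
  have UI : forall i, U [set n | forall j, (j <= i)%N -> B j n].
    elim=> [|i IH].
      by apply: filterS (UB 0%N) => n Bn j; rewrite leqn0 => /eqP ->.
    apply: filterS (filterI IH (UB i.+1)) => n /= [Bn Bi] j.
    by rewrite leq_eqVlt => /predU1P[->//|]; exact: Bn.
  have Ug : U [set n | (p.2 < n)%N] by apply: Uoo; exists p.2.+1.
  by have [n [/= h1 h2]] := filter_ex (filterI Ug (UI p.1)); exists n.
have [next hn] := choice nextP.
pose phi := fix phi j := if j is j'.+1 then next (j, phi j') else next (0%N, 0%N).
have phiB j i : (i <= j)%N -> B i (phi j).
  by case: j => [|j] ij; apply: (hn (_, _)).2.
exists phi.
  by apply/increasing_seqP => j; exact: (hn (_, _)).1.
move=> i; exists (pickle i) => // j /= /phiB.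
by rewrite /B pickleK.
Qed.

Lemma ultra_subsequence_cvg (R : realType) (I J : countType)
    (a : I -> nat -> R) (l : I -> R) (A : J -> set nat) :
  (forall i, a i k @[k --> U] --> l i) -> (forall j, U (A j)) ->
  exists phi : nat -> nat, [/\ increasing_seq phi,
    forall i, a i (phi k) @[k --> \oo] --> l i &
    forall j, \forall k \near \oo, A j (phi k)].
Proof.
move=> al UA.
pose B (p : I * nat + J) : set nat := match p with
  | inl (i, n) => [set k | `|l i - a i k| <= n.+1%:R^-1]
  | inr j => A j end.
have [|phi phi_incr hphi] := ultra_subsequence _ B.
  by case=> [[i n]|j] /=; [have /cvgrPdist_le/(_ n.+1%:R^-1) := al i; apply|exact: UA].
exists phi; split => // [i|j]; last exact: (hphi (inr j)).
apply/cvgrPdist_le => e e0.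
have [n ne] : exists n : nat, n.+1%:R^-1 <= e.
  exists (Num.trunc e^-1); rewrite -[leRHS]invrK lef_pV2 ?posrE ?invr_gt0//.
  by apply: ltW; apply: truncnS_gt.
by apply: filterS (hphi (inl (i, n))) => k /= /le_trans; apply.
Qed.

End UltraSubsequences.

(** * The group of a dislocation space *)

Section Group.
Context {R : realType} {X : completeNormedModType R}.
Context {F : X -> R} {D : set (X -> X)} (hD : dislocation_space F D).
Implicit Types (x y : X) (g h : X -> X).

Lemma D_lin {g} : D g -> exists h : {linear X -> X}, g = h.
Proof.
move=> /(ds_linear hD) gL.
pose A := GRing.isLinear.Build R X X *:%R g gL.
by pose h : {linear X -> X} := HB.pack g A; exists h.
Qed.

Lemma D_F {g} x : D g -> F (g x) = F x.
Proof. by move=> /(ds_invariant hD) e; rewrite -[RHS](congr1 (@^~ x) e). Qed.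

Lemma D_norm {g} x : D g -> `|g x| = `|x|.
Proof.
move=> gD; rewrite !(ds_norm hD); congr inf; apply/seteqP.
by have [h e] := D_lin gD; split=> lam /= [l0]; rewrite -[F (lam^-1 *: x)](D_F _ gD) e linearZ.
Qed.

Lemma DD {g} : D g -> {morph g : x y / x + y}.
Proof. by move=> /D_lin[h ->] x y; rewrite linearD. Qed.

Lemma DB {g} : D g -> {morph g : x y / x - y}.
Proof. by move=> /D_lin[h ->] x y; rewrite linearB. Qed.

Lemma D0 {g} : D g -> g 0 = 0.
Proof. by move=> /D_lin[h ->]; rewrite linear0. Qed.

Lemma D_opinv {g} : D g -> D (opinv g).
Proof. by move=> /(ds_inv hD)[]. Qed.

Lemma opinvK {g} : D g -> cancel g (opinv g).
Proof.
move=> /(ds_inv hD)[gb _] x; apply: pinvKV; rewrite ?inE//.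
by move=> a b _ _; exact: bij_inj.
Qed.

Lemma opinvKV {g} : D g -> cancel (opinv g) g.
Proof.
move=> gD; have [[gi gK giK] _] := ds_inv hD gD.
by move=> x; rewrite -{1}(giK x) opinvK.
Qed.

Lemma opinv_opinv {g} : D g -> opinv (opinv g) = g.
Proof.
move=> gD; apply/funext => x.
by rewrite -[in LHS](opinvK gD x) opinvK//; exact: D_opinv.
Qed.

Lemma opinv_id : opinv (@idfun X) = idfun.
Proof. by apply/funext => x; rewrite -[RHS](opinvKV (ds_id hD)). Qed.

Lemma le1_norm x : F x <= 1 -> `|x| <= 1.
Proof.
move=> Fx; rewrite (ds_norm hD); apply: ge_inf; last by rewrite /= invr1 scale1r ltr01.
by exists 0 => l /= [/ltW].
Qed.

(** If [F x < 1] then [F (l *: x) < 1] for some [l > 1], so that [`|x| < 1]. *)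
Lemma F_ge1 x : 1 <= `|x| -> 1 <= F x.
Proof.
move=> nx; rewrite leNgt; apply/negP => Fx.
have c1 : l *: x @[l --> (1 : R)] --> x.
  by rewrite -[X in _ --> X]scale1r; apply: cvgZr_tmp; exact: cvg_id.
have cF : F z @[z --> x] --> F x by exact: ds_continuous hD x.
have c : F (l *: x) @[l --> (1 : R)] --> F x := cvg_comp _ _ c1 cF.
have : \forall l \near (1 : R), F (l *: x) < 1 by exact: (cvgr_lt _ c).
move=> /nbhs_ballP[d /= d0 /(_ (1 + d / 2))]; rewrite -ball_normE /= opprD addNKr normrN.
rewrite gtr0_norm ?divr_gt0// ltr_pdivrMr// ltr_pMr// ltr1n => /(_ isT) Fl.
have l1 : 1 < 1 + d / 2 by rewrite ltrDl divr_gt0.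
have l0 : 0 < 1 + d / 2 by exact: lt_trans l1.
suff : `|x| <= (1 + d / 2)^-1.
  by apply/negP; rewrite -ltNge (lt_le_trans _ nx)// invf_lt1.
rewrite (ds_norm hD); apply: ge_inf; first by exists 0 => l /= [/ltW].
by split => /=; [rewrite invr_gt0 | rewrite invrK ltW].
Qed.

(** Uniform continuity on balls makes [F] bounded on balls. *)
Lemma F_bounded (r : R) : exists B : R, forall x, `|x| <= r -> F x <= B.
Proof.
have bA : bounded_set [set x : X | `|x| <= r].
  by exists r; split=> [|M rM x /= xr]; [exact: num_real | apply: le_trans xr (ltW rM)].
have [d d0 hd] := ds_unif_continuous hD bA ltr01.
pose N := Num.trunc (`|r| / d).
exists N.+1%:R => x xr.
have N0 : 0 < N.+1%:R :> R by [].
suff h : forall i, (i <= N.+1)%N -> F ((i%:R / N.+1%:R) *: x) <= i%:R.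
  by have := h N.+1 (leqnn _); rewrite divff ?gt_eqF// scale1r.
have inA i : (i <= N.+1)%N -> `|(i%:R / N.+1%:R) *: x| <= r.
  move=> iN; apply: le_trans xr; rewrite normrZ ler_piMl// ger0_norm ?divr_ge0//.
  by rewrite ler_pdivrMr// mul1r ler_nat.
elim=> [_|i IH iN]; first by rewrite mul0r scale0r (F0 hD).
have := hd _ _ (inA _ iN) (inA _ (ltnW iN)); rewrite -scalerBl -mulrBl -[i.+1]addn1 natrD.
rewrite addrAC subrr add0r mul1r normrZ gtr0_norm ?invr_gt0// => /(_ _)/ltr_normlW hs.
have {}hs : F ((i.+1%:R / N.+1%:R) *: x) - F ((i%:R / N.+1%:R) *: x) < 1.
  rewrite -[i.+1]addn1 natrD; apply: hs; rewrite mulrC ltr_pdivrMr// mulrC -ltr_pdivrMr//.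
  apply: le_lt_trans (truncnS_gt (`|r| / d)).
  by rewrite ler_pM2r ?invr_gt0//; apply: le_trans (ler_norm r).
have := IH (ltnW iN); rewrite -[i.+1]addn1 natrD in hs *; lra.
Qed.

End Group.

(** * Weak convergence tested on countably many functionals *)

Section WeakCriteria.
Context {R : realType} {X : completeNormedModType R}.
Context {F : X -> R} {D : set (X -> X)} (hD : dislocation_space F D).

(** Pointwise weak convergence to zero of a sequence of operators along a
    filter; for the Frechet filter it is [op_wcvg0]. *)
Definition op_wcvg0_along (G : set_system nat) (h : nat -> X -> X) :=
  forall x, wcvg_along G (fun k => h k x) 0.

Lemma dual0 (f : X -> R^o) : dual_space f -> f 0 = 0.
Proof. by move=> /dual_linP[h ->]; rewrite linear0. Qed.

Lemma dualB (f : X -> R^o) x y : dual_space f -> f (x - y) = f x - f y.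
Proof. by move=> /dual_linP[h ->]; rewrite linearB. Qed.

Lemma ultra_above_eventually : exists U : set_system nat, UltraFilter U /\ \oo `<=` U.
Proof. exact: ultraFilterLemma. Qed.

Lemma weak_limit_unique (G : set_system nat) (FG : ProperFilter G) (v : nat -> X) l l' :
  wcvg_along G v l -> wcvg_along G v l' -> l = l'.
Proof.
move=> h h'; have [f fD fsep] := separating_family hD.
apply/eqP; rewrite -subr_eq0; apply/eqP/fsep => i.
have e : f i l = f i l' by apply: (cvg_unique _ (h _ (fD i)) (h' _ (fD i))).
by rewrite dualB// e subrr.
Qed.

(** Since bounded sequences have weak limits along ultrafilters, a separating
    family of functionals is enough to test the weak convergence of a bounded
    sequence. *)
Lemma wcvg_separating (f : nat -> X -> R^o) (v : nat -> X) (l : X) (C : R) :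
  (forall i, dual_space (f i)) -> (forall x, (forall i, f i x = 0) -> x = 0) ->
  (forall k, `|v k| <= C) ->
  (forall i, f i (v k) @[k --> \oo] --> (f i l : R^o)) -> wcvg v l.
Proof.
move=> fD fsep vC fv h hdual; apply: contrapT => nh.
have [e [e0 he]] : exists e : R, 0 < e /\
    forall N, exists k, (N <= k)%N /\ e <= `|h l - h (v k)|.
  apply: contrapT => no; apply: nh; apply/cvgrPdist_lt => e e0.
  apply: contrapT => ne; apply: no; exists e; split => // N.
  apply: contrapT => noN; apply: ne; exists N => // k /= Nk.
  by rewrite ltNge; apply/negP => ek; apply: noN; exists k.
have [psi hpsi] := choice he.
have [U [UU Uoo]] := ultra_above_eventually.
have UP : ProperFilter U := ultra_proper.
have psioo : psi @ \oo --> \oo.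
  move=> A [N _ NA]; exists N => // k /= Nk; apply: NA => /=.
  exact: leq_trans Nk (hpsi k).1.
have [x hx] := ultra_weak_limit (ds_reflexive hD) (v \o psi) C (fun k => vC _).
have xl : x = l.
  apply/eqP; rewrite -subr_eq0; apply/eqP/fsep => i.
  have c1 := hx _ (fD i).
  have c2 : f i (v (psi k)) @[k --> U] --> (f i l : R^o).
    by apply: cvg_trans (cvg_comp _ _ psioo (fv i)); exact: cvg_app.
  have e1 : f i x = f i l by apply: (cvg_unique _ c1 c2).
  by rewrite dualB// e1 subrr.
have /cvgrPdist_lt/(_ e e0) := hx _ hdual.
rewrite xl => /filter_ex[k] /=; apply/negP; rewrite -leNgt.
exact: (hpsi k).2.
Qed.

Lemma op_wcvg0_separating (f : nat -> X -> R^o) (c : nat -> X) (h : nat -> X -> X) :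
  (forall i, dual_space (f i)) -> (forall x, (forall i, f i x = 0) -> x = 0) ->
  (forall x (e : R), 0 < e -> exists i, `|x - c i| < e) ->
  (forall k, D (h k)) ->
  (forall i j, f i (h k (c j)) @[k --> \oo] --> (0 : R^o)) -> op_wcvg0 h.
Proof.
move=> fD fsep cd hDk hfc x.
apply: (wcvg_separating f _ _ `|x|) => //.
  by move=> k; rewrite (D_norm hD).
move=> i; rewrite dual0//; apply/cvgrPdist_le => e e0.
have [C C0 hC] := dual_bounded (fD i).
have eC : 0 < e / 2 / C by rewrite !divr_gt0.
have [j xj] := cd x _ eC.
have e2 : 0 < e / 2 by rewrite divr_gt0.
have /cvgrPdist_le/(_ _ e2) := hfc i j.
apply: filterS => k; rewrite !sub0r !normrN => h1.
have [g gE] := dual_linP (fD i).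
have -> : f i (h k x) = f i (h k (c j)) + f i (h k (x - c j)).
  by rewrite gE -linearD -(DD hD)// addrC subrK.
rewrite [e]splitr; apply: le_trans (ler_normD _ _) _; apply: lerD => //.
apply: le_trans (hC _) _; rewrite (D_norm hD)// mulrC -ler_pdivlMr//.
exact: ltW.
Qed.

Section Extract.
Context {U : set_system nat} {UU : UltraFilter U} (Uoo : \oo `<=` U).

Let UP : ProperFilter U := ultra_proper.
Local Existing Instance UP.

(** Countably many weak limits along the ultrafilter are classical weak limits
    along a common subsequence. *)
Lemma ultra_subsequence_weak (I J K : countType) (v : I -> nat -> X) (l : I -> X)
    (h : J -> nat -> X -> X) (A : K -> set nat) :
  (forall i, exists C : R, forall k, `|v i k| <= C) ->
  (forall i, wcvg_along U (v i) (l i)) ->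
  (forall j k, D (h j k)) -> (forall j, op_wcvg0_along U (h j)) ->
  (forall n, U (A n)) ->
  exists phi : nat -> nat, [/\ increasing_seq phi,
    forall i, wcvg (fun k => v i (phi k)) (l i),
    forall j, op_wcvg0 (fun k => h j (phi k)) &
    forall n, \forall k \near \oo, A n (phi k)].
Proof.
move=> vb vl hDk h0 UA.
have [f fD fsep] := separating_family hD.
have [c cd] := dense_sequence hD.
pose a (p : (nat * I) + (nat * nat * J)) : nat -> R := match p with
  | inl (n, i) => fun k => f n (v i k)
  | inr (n, m, j) => fun k => f n (h j k (c m)) end.
pose b (p : (nat * I) + (nat * nat * J)) : R := match p with
  | inl (n, i) => f n (l i)
  | inr (n, m, j) => 0 end.
have [| |phi [phi_incr phia phiA]] := ultra_subsequence_cvg Uoo R _ _ a b A.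
- case=> [[n i]|[[n m] j]] /=; first exact: vl.
  by rewrite -(dual0 _ (fD n)); exact: h0.
- exact: UA.
exists phi; split => //.
- move=> i; have [C hC] := vb i.
  apply: (wcvg_separating f _ _ C) => // n; exact: (phia (inl (n, i))).
- move=> j; apply: (op_wcvg0_separating f c) => // n m.
  exact: (phia (inr (n, m, j))).
Qed.

End Extract.

End WeakCriteria.

(** * Dislocations along an ultrafilter *)

Section UltraDislocation.
Context {R : realType} {X : completeNormedModType R}.
Context {F : X -> R} {D : set (X -> X)} (hD : dislocation_space F D).
Context {U : set_system nat} {UU : UltraFilter U} (Uoo : \oo `<=` U).

Let UP : ProperFilter U := ultra_proper.
Local Existing Instance UP.

Lemma increasing_seq_cvg (psi : nat -> nat) : increasing_seq psi -> psi @ \oo --> \oo.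
Proof.
move=> psi_incr A [N _ NA]; exists N => // k /= Nk; apply: NA => /=.
apply: leq_trans Nk _; elim: k => // k IH.
by apply: leq_ltn_trans IH _; rewrite (leqW_mono psi_incr).
Qed.

Lemma not_ultra_cvg (a : nat -> R) (l : R) : ~ (a k @[k --> U] --> l) ->
  exists2 e : R, 0 < e & U [set k | e <= `|l - a k|].
Proof.
move=> na; apply: contrapT => no; apply: na; apply/cvgrPdist_lt => e e0.
have [//|Ue] := in_ultra_setVsetC [set k | `|l - a k| < e] UU.
case: no; exists e => //; apply: filterS Ue => k /=.
by rewrite leNgt => /negP.
Qed.

(** The form of [ds_subsequence] along the ultrafilter. *)
Lemma ultra_dislocation (g : nat -> X -> X) (v : nat -> X) (w : X) (C : R) :
  (forall k, D (g k)) -> (forall k, `|v k| <= C) ->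
  wcvg_along U v 0 -> wcvg_along U (fun k => g k (v k)) w -> w != 0 ->
  op_wcvg0_along U g.
Proof.
move=> gD vC v0 gvw w0 x f fD; apply: contrapT => /not_ultra_cvg[e e0 he].
rewrite dual0// in he.
pose V (b : bool) k := if b then v k else g k (v k).
pose L (b : bool) := if b then 0 else w.
have [| | | | |phi [phi_incr hv _ hA]] := @ultra_subsequence_weak R X F D hD U UU Uoo
    bool Empty_set unit V L (fun i => match i with end) (fun=> [set k | e <= `|0 - f (g k x)|]).
- by move=> b; exists C => k; case: b => //=; rewrite (D_norm hD).
- by case.
- by case.
- by case.
- by [].
have [| | |psi psi_incr hpsi] := ds_subsequence hD (g := g \o phi) (u := v \o phi).
- by move=> k; exact: gD.
- move=> /(_ x f fD); rewrite dual0// => /cvgrPdist_lt/(_ e e0) hlt.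
  have [k [/= h1 h2]] := filter_ex (filterI hlt (hA tt)).
  by move: h1; rewrite ltNge h2.
- exact: (hv true).
move/eqP: w0; apply; apply: (weak_limit_unique hD \oo _ _ _ _ _ hpsi).
move=> h hdual; exact: (cvg_comp _ _ (increasing_seq_cvg _ psi_incr) (hv false h hdual)).
Qed.

(** Apply [ultra_dislocation] to [opinv (g k)] and the null sequence [g k x]. *)
Lemma ultra_opinv (g : nat -> X -> X) : (forall k, D (g k)) ->
  op_wcvg0_along U g -> op_wcvg0_along U (fun k => opinv (g k)).
Proof.
move=> gD g0; have [[x /eqP x0]|X0] := pselect (exists x : X, x <> 0).
  apply: (@ultra_dislocation _ (fun k => g k x) x `|x|) => //.
  - by move=> k; exact: (D_opinv hD).
  - by move=> k; rewrite (D_norm hD).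
  - by under eq_fun do rewrite (opinvK hD)//; exact: wcvg_along_cst.
move=> x; have -> : (fun k => opinv (g k) x) = fun=> 0.
  by apply/funext => k; apply: contrapT => y0; apply: X0; exists (opinv (g k) x).
exact: wcvg_along_cst.
Qed.

Lemma D_sum (g : X -> X) (I : Type) (r : seq I) (P : pred I) (x : I -> X) : D g ->
  g (\sum_(i <- r | P i) x i) = \sum_(i <- r | P i) g (x i).
Proof. by move=> /(D_lin hD)[h ->]; rewrite linear_sum. Qed.

Lemma wcvg_along_sum (G : set_system nat) {FG : Filter G} (I : Type) (r : seq I) (P : pred I)
    (v : I -> nat -> X) (l : I -> X) : (forall i, P i -> wcvg_along G (v i) (l i)) ->
  wcvg_along G (fun k => \sum_(i <- r | P i) v i k) (\sum_(i <- r | P i) l i).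
Proof.
move=> vl; elim: r => [|i r IH].
  by under eq_fun do rewrite big_nil; rewrite big_nil; exact: wcvg_along_cst.
under eq_fun do rewrite big_cons; rewrite big_cons.
by case: ifP => // Pi; apply: wcvg_alongD => //; exact: vl.
Qed.

(** The second half of [ds_splitting] holds for arbitrary profiles: the sum
    [\sum_n g n k (w n)] is itself a bounded sequence with profiles [w]. *)
Lemma splitting_sum (M : nat) (g : 'I_M -> nat -> X -> X) (w : 'I_M -> X) :
  (forall n k, D (g n k)) ->
  (forall m n, m != n -> op_wcvg0 (fun k => opinv (g m k) \o g n k)) ->
  F (\sum_(n < M) g n k (w n)) @[k --> \oo] --> \sum_(n < M) F (w n).
Proof.
move=> gD g0; pose u k := \sum_(n < M) g n k (w n).
have ub : bounded_fun u.
  exists (\sum_(n < M) `|w n|); split=> [|B hB k _ /=]; first exact: num_real.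
  apply: le_trans (ltW hB); apply: le_trans (ler_norm_sum _ _ _) _.
  by apply: ler_sum => i _; rewrite (D_norm hD).
apply: (ds_splitting hD gD g0 ub _).2 => n f fD.
have -> : w n = \sum_(i < M) (if i == n then w n else 0).
  by rewrite -big_mkcond /= big_pred1_eq.
suff : wcvg_along \oo (fun k => opinv (g n k) (u k)) (\sum_(i < M) (if i == n then w n else 0)).
  exact.
have -> : (fun k => opinv (g n k) (u k)) = fun k => \sum_(i < M) opinv (g n k) (g i k (w i)).
  by apply/funext => k; rewrite /u D_sum//; exact: (D_opinv hD).
apply: wcvg_along_sum => i _; case: eqVneq => [->|ni].
  by under eq_fun do rewrite (opinvK hD)//; exact: wcvg_along_cst.
by apply: g0; rewrite eq_sym.
Qed.

Lemma ultra_splitting_sum (M : nat) (g : 'I_M -> nat -> X -> X) (w : 'I_M -> X) :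
  (forall n k, D (g n k)) ->
  (forall m n, m != n -> op_wcvg0_along U (fun k => opinv (g m k) \o g n k)) ->
  F (\sum_(n < M) g n k (w n)) @[k --> U] --> \sum_(n < M) F (w n).
Proof.
move=> gD g0; apply: contrapT => /not_ultra_cvg[e e0 he].
pose J := {p : 'I_M * 'I_M | p.1 != p.2}.
have [| | | | |phi [phi_incr _ h0 hA]] := @ultra_subsequence_weak R X F D hD U UU Uoo
    Empty_set J unit (fun i => match i with end) (fun i => match i with end)
    (fun j k => opinv (g (val j).1 k) \o g (val j).2 k)
    (fun=> [set k | e <= `|\sum_(n < M) F (w n) - F (\sum_(n < M) g n k (w n))|]).
- by case.
- by case.
- by move=> j k; apply: (ds_comp hD) => //; exact: (D_opinv hD).
- by move=> j; apply: g0; exact: (valP j).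
- by [].
have c : F (\sum_(n < M) g n (phi k) (w n)) @[k --> \oo] --> \sum_(n < M) F (w n).
  apply: (@splitting_sum M (fun n k => g n (phi k))) => // m n mn.
  exact: (h0 (exist _ (m, n) mn)).
have /cvgrPdist_lt/(_ e e0) hlt := c.
have [k [/= h1 h2]] := filter_ex (filterI hlt (hA tt)).
by move: h1; rewrite ltNge h2.
Qed.

(** The first half of [ds_splitting], for a bound on [F] along the sequence. *)
Lemma ultra_splitting_le (M : nat) (g : 'I_M -> nat -> X -> X) (u : nat -> X)
    (w : 'I_M -> X) (B C : R) :
  (forall n k, D (g n k)) ->
  (forall m n, m != n -> op_wcvg0_along U (fun k => opinv (g m k) \o g n k)) ->
  (forall k, `|u k| <= C) -> (forall k, F (u k) <= B) ->
  (forall n, wcvg_along U (fun k => opinv (g n k) (u k)) (w n)) ->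
  \sum_(n < M) F (w n) <= B.
Proof.
move=> gD g0 uC uB uw.
pose J := {p : 'I_M * 'I_M | p.1 != p.2}.
have [| | | | |phi [phi_incr hw h0 _]] := @ultra_subsequence_weak R X F D hD U UU Uoo
    'I_M J Empty_set (fun n k => opinv (g n k) (u k)) w
    (fun j k => opinv (g (val j).1 k) \o g (val j).2 k) (fun i => match i with end).
- by move=> n; exists C => k; rewrite (D_norm hD)//; exact: (D_opinv hD).
- by [].
- by move=> j k; apply: (ds_comp hD) => //; exact: (D_opinv hD).
- by move=> j; apply: g0; exact: (valP j).
- by case.
have ub : bounded_fun (u \o phi).
  by exists C; split=> [|r Cr k _ /=]; [exact: num_real | apply: le_trans (ltW Cr)].
have [|h _] := @ds_splitting _ _ _ _ hD M (fun n => g n \o phi) (u \o phi) w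
  (fun n k => gD n _) _ ub hw.
  by move=> m n mn; exact: (h0 (exist _ (m, n) mn)).
rewrite -lee_fin; apply: le_trans h _; apply: le_trans (limn_einf_sup _) _.
apply: ge_ereal_inf; exists (ereal_sup ((fun k => (F (u (phi k)))%:E) @` setT)).
  by exists setT => //; exact: filterT.
by apply: ge_ereal_sup => _ [k _ <-]; rewrite lee_fin.
Qed.

End UltraDislocation.

(** * Choosing the profiles along an ultrafilter *)

Section Profiles.
Context {R : realType} {X : completeNormedModType R}.
Context {F : X -> R} {D : set (X -> X)} (hD : dislocation_space F D).
Context {U : set_system nat} {UU : UltraFilter U} (Uoo : \oo `<=` U).

Let UP : ProperFilter U := ultra_proper.
Local Existing Instance UP.

(** What is left of [u] after removing the first [n] profiles. *)
Definition remainder (u : nat -> X) (g : nat -> nat -> X -> X) (w : nat -> X)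
  (n k : nat) : X := u k - \sum_(0 <= i < n) g i k (w i).

(** The indices carrying a genuine profile: the weak limit of [u] itself always
    counts, even when it vanishes. *)
Definition profile_index (w : nat -> X) : pred nat := fun n => (n == 0%N) || (w n != 0).

(** A sequence of profiles of [u] along the ultrafilter in which every profile
    after the first is, up to a factor, at least as large as any dislocated weak
    limit of the remainder. *)
Record profile_system (u : nat -> X) (g : nat -> nat -> X -> X) (w : nat -> X) : Prop := {
  ps_D : forall n k, D (g n k) ;
  ps_id : forall k, g 0%N k = idfun ;
  ps_orth : forall m n, profile_index w m -> profile_index w n -> m != n ->
    op_wcvg0_along U (fun k => opinv (g m k) \o g n k) ;
  ps_lim : forall n, profile_index w n -> wcvg_along U (fun k => opinv (g n k) (u k)) (w n) ;
  ps_max : forall n, (0 < n)%N -> forall (h : nat -> X -> X) (z : X), (forall k, D (h k)) ->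
    wcvg_along U (fun k => h k (remainder u g w n k)) z ->
    Num.min 1 (F z) <= 2 * F (w n) ;
  ps_prev : forall n, profile_index w n.+1 -> profile_index w n }.

(** Among the dislocated weak limits of [v], there is a [w] such that [F w] is at
    least half the supremum of [F], truncated at 1 so that the supremum is
    finite. *)
Lemma greedy_step (v : nat -> X) (C : R) : (forall k, `|v k| <= C) ->
  exists (h : nat -> X -> X) (w : X), [/\ forall k, D (h k),
    wcvg_along U (fun k => h k (v k)) w &
    forall (h' : nat -> X -> X) (z : X), (forall k, D (h' k)) ->
      wcvg_along U (fun k => h' k (v k)) z -> Num.min 1 (F z) <= 2 * F w].
Proof.
move=> vC.
pose S : set R := [set r | exists (h : nat -> X -> X) (w : X),
  [/\ forall k, D (h k), wcvg_along U (fun k => h k (v k)) w & r = Num.min 1 (F w)]].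
have Sub : ubound S 1 by move=> _ [h [w [_ _ ->]]]; rewrite ge_min lexx.
have [w0 hw0] := ultra_weak_limit (ds_reflexive hD) v C vC.
have Sw0 : S (Num.min 1 (F w0)).
  by exists (fun=> idfun), w0; split => // k; exact: (ds_id hD).
have Ssup : has_sup S by split; [exists (Num.min 1 (F w0)) | exists 1].
have [s0|s0] := leP (sup S) 0.
  exists (fun=> idfun), w0; split => // [k|h z hDk hz]; first exact: (ds_id hD).
  apply: (@le_trans _ _ 0); last by rewrite mulr_ge0// (ds_ge0 hD).
  by apply: le_trans s0; apply: (sup_upper_bound Ssup); exists h, z.
have s2 : 0 < sup S / 2 by rewrite divr_gt0.
have [_ [h [w [hDk hw ->]]] hlt] := sup_adherent s2 Ssup.
exists h, w; split => // h' z h'D hz.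
have : Num.min 1 (F z) <= sup S by apply: (sup_upper_bound Ssup); exists h', z.
have : Num.min 1 (F w) <= F w by rewrite ge_min lexx orbT.
lra.
Qed.

(** Successive choices: the identity first, then a greedy step applied to each
    remainder. *)
Lemma greedy_profiles (u : nat -> X) (C : R) : (forall k, `|u k| <= C) ->
  exists (g : nat -> nat -> X -> X) (w : nat -> X),
  [/\ forall n k, D (g n k), forall k, g 0%N k = idfun,
    forall n, wcvg_along U (fun k => opinv (g n k) (remainder u g w n k)) (w n) &
    forall n, (0 < n)%N -> forall (h : nat -> X -> X) (z : X), (forall k, D (h k)) ->
      wcvg_along U (fun k => h k (remainder u g w n k)) z -> Num.min 1 (F z) <= 2 * F (w n)].
Proof.
move=> uC.
(* [step (n, v)] is the pair of inverse dislocation and profile chosen at rank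
   [n] when the remainder is [v]; only bounded [v] matter. *)
have /choice[step hstep] : forall p : nat * (nat -> X), exists q : (nat -> X -> X) * X,
    (exists C, forall k, `|p.2 k| <= C) ->
    [/\ forall k, D (q.1 k), wcvg_along U (fun k => q.1 k (p.2 k)) q.2,
      p.1 = 0%N -> q.1 = fun=> idfun &
      (0 < p.1)%N -> forall (h' : nat -> X -> X) (z : X), (forall k, D (h' k)) ->
      wcvg_along U (fun k => h' k (p.2 k)) z -> Num.min 1 (F z) <= 2 * F q.2].
  case=> n v /=; have [[K vK]|no] := pselect (exists C, forall k, `|v k| <= C); last first.
    by exists (fun=> idfun, 0).
  case: n => [|n].
    have [w0 hw0] := ultra_weak_limit (ds_reflexive hD) v K vK.
    by exists (fun=> idfun, w0) => _; split => // k; exact: (ds_id hD).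
  by have [h [w [hDk hw hmax]]] := greedy_step _ _ vK; exists (h, w).
pose vs := fix vs n : nat -> X := if n is n'.+1 then
  (fun k => vs n' k - opinv ((step (n', vs n')).1 k) (step (n', vs n')).2) else u.
have vsS n k : vs n.+1 k = vs n k - opinv ((step (n, vs n)).1 k) (step (n, vs n)).2 by [].
have vsb n : exists C, forall k, `|vs n k| <= C.
  elim: n => [|n [K hK]]; first by exists C.
  have [gD _ _ _] := hstep (n, vs n) (ex_intro _ K hK).
  exists (K + `|(step (n, vs n)).2|) => k; rewrite vsS.
  apply: le_trans (ler_normB _ _) _; apply: lerD => //.
  by rewrite (D_norm hD)//; exact: (D_opinv hD).
pose g n k := opinv ((step (n, vs n)).1 k).
pose w n := (step (n, vs n)).2.
have vsE n : vs n = remainder u g w n.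
  apply/funext => k; rewrite /remainder.
  elim: n => [|n IH]; first by rewrite big_nil subr0.
  by rewrite big_nat_recr//= opprD addrA -IH.
exists g, w; split.
- by move=> n k; apply: (D_opinv hD); have [gD _ _ _] := hstep (n, vs n) (vsb n).
- move=> k; have [_ _ + _] := hstep (0%N, vs 0%N) (vsb 0%N).
  by move=> /(_ erefl) e; rewrite /g e (opinv_id hD).
- move=> n; have [gD + _ _] := hstep (n, vs n) (vsb n).
  by rewrite -vsE /g; under [in X in _ -> X]eq_fun do rewrite (opinv_opinv hD)//.
- move=> n n0; have [_ _ _ /(_ n0)] := hstep (n, vs n) (vsb n).
  by rewrite -vsE.
Qed.

(** Orthogonality comes from [ultra_dislocation]: for [m < n] the sequence
    [opinv (g m k) (remainder u g w n k)] tends weakly to zero, whereas applying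
    [opinv (g n k) \o g m k] to it gives the nonzero limit [w n]. *)
Lemma profile_system_exists (u : nat -> X) (C : R) : (forall k, `|u k| <= C) ->
  exists (g : nat -> nat -> X -> X) (w : nat -> X), profile_system u g w.
Proof.
move=> uC; have [g [w [gD g0 gw gmax]]] := greedy_profiles u C uC.
have ogD m n k : D (opinv (g m k) \o g n k).
  by apply: (ds_comp hD) => //; exact: (D_opinv hD).
have remb n : exists K, forall k, `|remainder u g w n k| <= K.
  exists (C + \sum_(0 <= i < n) `|w i|) => k; apply: le_trans (ler_normB _ _) _.
  apply: lerD => //; apply: le_trans (ler_norm_sum _ _ _) _.
  by apply: ler_sum => i _; rewrite (D_norm hD).
have remS n k : remainder u g w n.+1 k = remainder u g w n k - g n k (w n).
  by rewrite /remainder big_nat_recr//= opprD addrA.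
have inv m n : op_wcvg0_along U (fun k => opinv (g n k) \o g m k) ->
    op_wcvg0_along U (fun k => opinv (g m k) \o g n k).
  move=> /(ultra_opinv hD Uoo _ (ogD n m)) h.
  have e : (fun k => opinv (opinv (g n k) \o g m k)) = (fun k => opinv (g m k) \o g n k).
    apply/funext => k; apply/funext => x /=.
    rewrite -[in LHS](opinvK hD (gD n k) x) -[X in opinv (g n k) X](opinvKV hD (gD m k)).
    by rewrite -[opinv (g n k) _]/((opinv (g n k) \o g m k) _) (opinvK hD).
  by rewrite -e.
have orth_of n : w n != 0 ->
    (forall m, (m < n)%N -> wcvg_along U (fun k => opinv (g m k) (remainder u g w n k)) 0) ->
    forall m, (m < n)%N -> op_wcvg0_along U (fun k => opinv (g n k) \o g m k).
  move=> wn hm m mn; have [K hK] := remb n.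
  apply: (ultra_dislocation hD Uoo _ (fun k => opinv (g m k) (remainder u g w n k)) (w n) K) => //.
  - by move=> k; rewrite (D_norm hD)//; exact: (D_opinv hD).
  - exact: hm.
  - by under eq_fun do rewrite /= (opinvKV hD)//; exact: gw.
have rem0 n m : (m < n)%N -> wcvg_along U (fun k => opinv (g m k) (remainder u g w n k)) 0.
  elim: n m => // n IH m; rewrite ltnS => mn.
  have remB k : opinv (g m k) (remainder u g w n k) - opinv (g m k) (g n k (w n)) =
      opinv (g m k) (remainder u g w n.+1 k).
    by rewrite remS (DB hD)//; exact: (D_opinv hD).
  move: mn; rewrite leq_eqVlt => /predU1P[mn|mn].
    apply: (eq_wcvg_along _ _ _ _ _ remB (subrr (w n))); apply: wcvg_alongB.
      by rewrite mn; exact: gw.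
    apply: (eq_wcvg_along _ (fun=> w n) _ _ _ _ erefl); last exact: wcvg_along_cst.
    by move=> k; rewrite mn (opinvK hD).
  apply: (eq_wcvg_along _ _ _ _ _ remB (subr0 0)); apply: wcvg_alongB; first exact: IH.
  have [wn|wn] := eqVneq (w n) 0.
    apply: (eq_wcvg_along _ (fun=> 0) _ _ _ _ erefl); last exact: wcvg_along_cst.
    by move=> k; rewrite wn (D0 hD (gD n _)) (D0 hD (D_opinv hD (gD m _))).
  by apply: (inv m n); exact: orth_of.
have orth m n : w n != 0 -> (m < n)%N -> op_wcvg0_along U (fun k => opinv (g n k) \o g m k).
  by move=> wn mn; apply: orth_of => // i; exact: rem0.
have idx n : (0 < n)%N -> profile_index w n -> w n != 0.
  by rewrite /profile_index; case: n.
exists g, w; split => //.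
- move=> m n mi ni; rewrite neq_ltn => /orP[mn|nm].
    by apply/inv/orth => //; apply: idx => //; exact: leq_ltn_trans mn.
  by apply: orth => //; apply: idx => //; exact: leq_ltn_trans nm.
- move=> n ni.
  have e k : opinv (g n k) (remainder u g w n k) +
      \sum_(i < n) (opinv (g n k) (g i k (w i))) = opinv (g n k) (u k).
    have onD := D_opinv hD (gD n k).
    by rewrite -(D_sum hD)// -(DD hD onD) /remainder big_mkord subrK.
  have s0 : w n + \sum_(i < n) 0 = w n by rewrite big1// addr0.
  apply: (eq_wcvg_along _ _ _ _ _ e s0); apply: wcvg_alongD; first exact: gw.
  apply: wcvg_along_sum => i _.
  by apply: (orth i n); [apply: idx => //; exact: leq_ltn_trans (ltn_ord i) | ].
(* A vanishing profile leaves the remainder unchanged, so by maximality the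
   next one vanishes too. *)
- move=> [//|n] /(idx n.+2 isT) wn; rewrite /profile_index orFb.
  apply: contra_neq wn => wn0.
  have rE : remainder u g w n.+2 = remainder u g w n.+1.
    by apply/funext => k; rewrite remS wn0 (D0 hD)// subr0.
  have := gmax n.+1 isT (fun k => opinv (g n.+2 k)) (w n.+2) (fun k => D_opinv hD (gD _ _)).
  rewrite -rE => /(_ (gw _)); rewrite wn0 (F0 hD) mulr0 ge_min leNgt ltr01 /= => h.
  by apply: (F_eq0 hD); apply/eqP; rewrite eq_le h (ds_ge0 hD).
Qed.

End Profiles.

#[global] Arguments ps_D {R X F D U u g w}.
#[global] Arguments ps_id {R X F D U u g w}.
#[global] Arguments ps_orth {R X F D U u g w}.
#[global] Arguments ps_lim {R X F D U u g w}.
#[global] Arguments ps_max {R X F D U u g w}.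
#[global] Arguments ps_prev {R X F D U u g w}.

(** * Uniform convergence of the profile series *)

Section UniformConvergence.
Context {R : realType} {X : completeNormedModType R}.
Context {F : X -> R} {D : set (X -> X)} (hD : dislocation_space F D).
Context {U : set_system nat} {UU : UltraFilter U} (Uoo : \oo `<=` U).

Let UP : ProperFilter U := ultra_proper.
Local Existing Instance UP.

Context {u : nat -> X} {C : R} (uC : forall k, `|u k| <= C).
Context {g : nat -> nat -> X -> X} {w : nat -> X}.
Hypothesis gw : @profile_system R X F D U u g w.

Lemma nneg_series_tail (a : nat -> R) (B : R) : (forall i, 0 <= a i) ->
  (forall n, \sum_(0 <= i < n) a i <= B) ->
  forall e : R, 0 < e -> exists m0, forall m n, (m0 <= m)%N ->
    \sum_(m <= i < n) a i <= e.
Proof.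
move=> a0 aB e e0; pose S : set R := range (fun n => \sum_(0 <= i < n) a i).
have Ssup : has_sup S.
  by split; [exists (\sum_(0 <= i < 0) a i), 0%N | exists B => _ [n _ <-]].
have [_ [m0 _ <-] hm0] := sup_adherent e0 Ssup.
exists m0 => m n m0m; have [mn|nm] := leqP m n; last by rewrite big_geq ?ltW// ltnW.
have h1 : \sum_(0 <= i < n) a i <= sup S by apply: (sup_upper_bound Ssup); exists n.
have : \sum_(0 <= i < n) a i =
    \sum_(0 <= i < m0) a i + \sum_(m0 <= i < m) a i + \sum_(m <= i < n) a i.
  by rewrite -!big_cat_nat//; exact: leq_trans mn.
have : 0 <= \sum_(m0 <= i < m) a i by apply: sumr_ge0.
lra.
Qed.

(** The profiles below rank [m] are replaced by zero, which
    [ultra_splitting_sum] allows. *)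
Lemma profile_partial_sum (m n : nat) : (forall i, (i < n)%N -> profile_index w i) ->
  F (\sum_(m <= i < n) g i k (w i)) @[k --> U] --> \sum_(m <= i < n) F (w i).
Proof.
move=> wi; pose w' (i : 'I_n) := if (m <= i)%N then w i else 0.
have := @ultra_splitting_sum R X F D hD U UU Uoo n (fun i => g i) w' _ _.
have -> : \sum_(i < n) F (w' i) = \sum_(m <= i < n) F (w i).
  rewrite big_geq_mkord [RHS]big_mkcond /=; apply: eq_bigr => i _; rewrite /w'.
  by case: ifP => // _; exact: (F0 hD).
have -> : (fun k => F (\sum_(i < n) g i k (w' i))) = fun k => F (\sum_(m <= i < n) g i k (w i)).
  apply/funext => k; congr F.
  rewrite big_geq_mkord [RHS]big_mkcond /=; apply: eq_bigr => i _; rewrite /w'.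
  by case: ifP => // _; exact: (D0 hD (ps_D gw _ _)).
apply; first by move=> i k; exact: (ps_D gw).
by move=> i j ij; apply: (ps_orth gw) => //; exact: wi.
Qed.

Lemma profile_sum_bounded : exists B : R, forall n, (forall i, (i < n)%N -> profile_index w i) ->
  \sum_(0 <= i < n) F (w i) <= B.
Proof.
have [B hB] := F_bounded hD C.
exists B => n wi; rewrite big_mkord.
apply: (@ultra_splitting_le R X F D hD U UU Uoo n (fun i => g i) u (fun i => w i) B C) => //.
- by move=> i k; exact: (ps_D gw).
- by move=> i j ij; apply: (ps_orth gw) => //; exact: wi.
- by move=> k; exact: hB.
- by move=> i; apply: (ps_lim gw); exact: wi.
Qed.

Section InfinitelyMany.
Hypothesis winf : forall n, profile_index w n.

(** [F] need not control the norm near zero in general. It does when there are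
    arbitrarily many asymptotically orthogonal dislocations. Let [M] bound [F]
    strictly on the ball of radius [e^-1]. If [F x < (2 M)^-1] then the sum of [M]
    dislocated copies of [x] has norm at most 1, so the sum of the copies of
    [e^-1 *: x] lies in that ball. If moreover [e < `|x|], then [F] at the latter
    sum is close to [M * F (e^-1 *: x) >= M], a contradiction. *)
Lemma F_coercive (e : R) : 0 < e -> exists2 d : R, 0 < d & forall x, F x < d -> `|x| <= e.
Proof.
move=> e0; have [B hB] := F_bounded hD e^-1.
pose M := (Num.trunc B).+1.
have BM : B < M%:R by exact: truncnS_gt.
have M0 : 0 < M%:R :> R by rewrite ltr0n.
exists (2 * M%:R)^-1; first by rewrite invr_gt0 mulr_gt0.
move=> x Fx; rewrite leNgt; apply/negP => ex.
have lim y : F (\sum_(n < M) g n k y) @[k --> U] --> F y *+ M.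
  have := @ultra_splitting_sum R X F D hD U UU Uoo M (fun i => g i) (fun=> y) _ _.
  rewrite sumr_const card_ord; apply; first by move=> i k; exact: (ps_D gw).
  by move=> i j ij; apply: (ps_orth gw).
have h1 : \forall k \near U, F (\sum_(n < M) g n k x) < 1.
  apply: (cvgr_lt _ (lim x)); rewrite -mulr_natr.
  have : F x * (2 * M%:R) < 1 by rewrite -ltr_pdivlMr ?mulr_gt0// mul1r.
  have : 0 <= F x * M%:R by rewrite mulr_ge0// (ds_ge0 hD).
  lra.
have h2 : \forall k \near U, B < F (\sum_(n < M) g n k (e^-1 *: x)).
  apply: (cvgr_gt _ (lim _)); apply: lt_le_trans BM _; rewrite -[leRHS]mulr_natr ler_peMl//.
  apply: (F_ge1 hD); rewrite normrZ gtr0_norm ?invr_gt0// mulrC ler_pdivlMr// mul1r.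
  exact: ltW.
have [k [/= k1 k2]] := filter_ex (filterI h1 h2).
move: k2; apply/negP; rewrite -leNgt; apply: hB.
have -> : \sum_(n < M) g n k (e^-1 *: x) = e^-1 *: \sum_(n < M) g n k x.
  rewrite scaler_sumr; apply: eq_bigr => n _.
  by have [h ->] := D_lin hD (ps_D gw n k); rewrite linearZ.
rewrite normrZ gtr0_norm ?invr_gt0//; apply: ler_piMr; first by rewrite invr_ge0 ltW.
by apply: (le1_norm hD); exact: ltW.
Qed.

(** Some dislocation pushes [x] far away from finitely many vectors. *)
Lemma far_dislocation (N : nat) (y : 'I_N -> X) (x : X) (e : R) : 0 < e ->
  exists2 h, D h & forall m, F (y m + h x) <= F (y m) + F x + e.
Proof.
move=> e0; pose h k := opinv (g 0%N k) \o g 1%N k.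
have hDk k : D (h k) by apply: (ds_comp hD); [apply: (D_opinv hD)|]; exact: (ps_D gw).
have h0 : op_wcvg0_along U h by apply: (ps_orth gw).
have lim m : F (y m + h k x) @[k --> U] --> F (y m) + F x.
  pose g2 (i : 'I_2) k := if i == ord0 then idfun else h k.
  pose w2 (i : 'I_2) := if i == ord0 then y m else x.
  have := @ultra_splitting_sum R X F D hD U UU Uoo 2 g2 w2 _ _.
  have -> : \sum_(n < 2) F (w2 n) = F (y m) + F x by rewrite big_ord_recl big_ord1.
  have -> : (fun k => F (\sum_(n < 2) g2 n k (w2 n))) = fun k => F (y m + h k x).
    apply/funext => k; by rewrite big_ord_recl big_ord1.
  apply; first by move=> i k; rewrite /g2; case: ifP => // _; exact: (ds_id hD).
  move=> i j; rewrite /g2.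
  have [->|i0] := eqVneq i ord0; have [j0|j0] := eqVneq j ord0; rewrite ?eqxx//.
  - by move=> _; rewrite (opinv_id hD); exact: h0.
  - by move=> _; exact: (ultra_opinv hD Uoo).
  - by case: i i0 => [[|[|//]] hi]// _; case: j j0 => [[|[|//]] hj].
have : \forall k \near U, forall m, F (y m + h k x) <= F (y m) + F x + e.
  by apply: filter_forall => m; apply: (cvgr_le _ (lim m)); rewrite ltrDl.
by move=> /filter_ex[k hk]; exists (h k).
Qed.

(** For each [k] the dislocations are revised one rank after the other: [g n k]
    is kept if it adds at most [F (w n) + 2^-1 ^+ n] to [F] of every partial sum
    ending before [n], and replaced by a far dislocation otherwise. By
    [profile_partial_sum] the first case prevails along the ultrafilter. *)
Lemma modified_dislocations : exists g' : nat -> nat -> X -> X,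
  [/\ forall n k, D (g' n k), forall k, g' 0%N k = g 0%N k,
    forall n, \forall k \near U, g' n k = g n k &
    forall k m n, (m <= n)%N ->
      F (\sum_(m <= i < n.+1) g' i k (w i)) <=
      F (\sum_(m <= i < n) g' i k (w i)) + F (w n) + 2^-1 ^+ n].
Proof.
pose good n (prev : nat -> X -> X) (q : X -> X) := forall m, (m <= n)%N ->
  F (\sum_(m <= i < n) prev i (w i) + q (w n)) <=
  F (\sum_(m <= i < n) prev i (w i)) + F (w n) + 2^-1 ^+ n.
have /choice[pick hpick] : forall p : nat * (nat -> X -> X) * (X -> X), exists q,
    [/\ D q, good p.1.1 p.1.2 q & D p.2 -> good p.1.1 p.1.2 p.2 -> q = p.2].
  case=> [[n prev] q0] /=.
  have [[q0D q0g]|nq0] := pselect (D q0 /\ good n prev q0); first by exists q0.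
  have en : 0 < 2^-1 ^+ n :> R by rewrite exprn_gt0// invr_gt0.
  have [q qD hq] := far_dislocation n.+1 (fun m => \sum_(m <= i < n) prev i (w i)) (w n) _ en.
  exists q; split => [//|m mn|q0D q0g]; last by case: nq0.
  by have := hq (Ordinal (mn : (m < n.+1)%N)).
(* [hist k n] lists the revised dislocations of rank below [n]. *)
pose hist k := fix hist n : nat -> X -> X := if n is n'.+1 then
  (fun i => if i == n' then pick (n', hist n', g n' k) else hist n' i) else fun=> idfun.
pose g' n k := pick (n, hist k n, g n k).
have histE k n i : (i < n)%N -> hist k n i = g' i k.
  elim: n => // n IH; rewrite ltnS leq_eqVlt /= => /predU1P[->|ltin]; first by rewrite eqxx.
  by rewrite ltn_eqF// IH.
have goodE n p q h : (forall i, (i < n)%N -> p i = q i) -> good n p h -> good n q h.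
  move=> pq hp m mn.
  suff <- : \sum_(m <= i < n) p i (w i) = \sum_(m <= i < n) q i (w i) by exact: hp.
  by apply: eq_big_nat => i /andP[_ /pq ->].
have g'good k n : good n (g'^~ k) (g' n k).
  have [_ h _] := hpick (n, hist k n, g n k).
  by apply: (goodE _ (hist k n)) => // i; exact: histE.
exists g'; split.
- by move=> n k; have [] := hpick (n, hist k n, g n k).
- move=> k; have [_ _] := hpick (0%N, hist k 0%N, g 0%N k); apply; first exact: (ps_D gw).
  move=> m _; rewrite !big_geq// add0r (F0 hD) add0r (D_F hD _ (ps_D gw _ _)).
  by rewrite lerDl expr0 ler01.
- move=> n; have [N] := ubnP n; elim: N n => // N IH n nN.
  have agree : \forall k \near U, forall i : 'I_n, g' i k = g i k.
    by apply: filter_forall => i; apply: IH; exact: leq_trans (ltn_ord i) _.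
  have ggood : \forall k \near U, forall m : 'I_n.+1,
      F (\sum_(m <= i < n.+1) g i k (w i)) <=
      F (\sum_(m <= i < n) g i k (w i)) + F (w n) + 2^-1 ^+ n.
    apply: filter_forall => m.
    have c1 := profile_partial_sum m n (fun i _ => winf i).
    have c2 := profile_partial_sum m n.+1 (fun i _ => winf i).
    have en : 0 < 2^-1 ^+ n :> R by rewrite exprn_gt0// invr_gt0.
    have : \forall k \near U, F (\sum_(m <= i < n.+1) g i k (w i)) -
        F (\sum_(m <= i < n) g i k (w i)) <= F (w n) + 2^-1 ^+ n.
      apply: (cvgr_le _ (cvgB c2 c1)).
      have mn : (m <= n)%N by rewrite -ltnS.
      rewrite (big_nat_recr _ _ _ mn) /= addrAC subrr add0r.
      by rewrite ltrDl.
    by apply: filterS => k; rewrite lerBlDl addrA.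
  apply: filterS (filterI agree ggood) => k [agr gg].
  have [_ _] := hpick (n, hist k n, g n k); apply; first exact: (ps_D gw).
  apply: (goodE _ (g^~ k)) => [i ltin|m mn].
    by rewrite -[RHS]/(hist k n i) histE//; have := agr (Ordinal ltin).
  by have := gg (Ordinal (mn : (m < n.+1)%N)); rewrite /= big_nat_recr.
- by move=> k m n mn; rewrite big_nat_recr//; exact: g'good.
Qed.

End InfinitelyMany.

(** The dislocations can be changed on a null set of the ultrafilter so that the
    profile series converges uniformly; the dislocated weak limits of the
    remainders tend to zero. *)
Lemma uniform_profiles : exists g' : nat -> nat -> X -> X,
  [/\ forall n k, D (g' n k), forall k, g' 0%N k = g 0%N k,
    forall n, \forall k \near U, g' n k = g n k,
    forall e : R, 0 < e -> exists m0, forall m n k, (m0 <= m)%N ->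
      `|\sum_(m <= i < n) g' i k (w i)| <= e &
    forall (e : R) (m0 : nat), 0 < e -> exists2 n, (m0 <= n)%N &
      forall (h : nat -> X -> X) (z : X), (forall k, D (h k)) ->
        wcvg_along U (fun k => h k (remainder u g w n k)) z -> `|z| <= e].
Proof.
have [winf|/existsNP[K /negP wK]] := pselect (forall n, profile_index w n); last first.
  have wK0 n : (K <= n)%N -> ~~ profile_index w n.
    elim: n => [|n IH]; first by rewrite leqn0 => /eqP <-.
    rewrite leq_eqVlt => /predU1P[<-//|/IH]; exact/contra/(ps_prev gw).
  have w0 n : (K <= n)%N -> w n = 0.
    by move=> /wK0; rewrite /profile_index negb_or negbK => /andP[_ /eqP].
  have K0 : (0 < K)%N by move: wK; rewrite /profile_index; case: (K).
  exists g; split => //; first exact: (ps_D gw).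
  - by move=> n; exact: nearW.
  - move=> e e0; exists K => m n k Km; rewrite big_nat_cond big1 ?normr0 ?ltW// => i.
    by move=> /andP[/andP[mi _] _]; rewrite w0 ?(D0 hD (ps_D gw _ _))//; exact: leq_trans mi.
  - move=> e m0 e0; exists (maxn K m0); first exact: leq_maxr.
    move=> h z hDk hz; have nK : (K <= maxn K m0)%N by exact: leq_maxl.
    have := ps_max gw _ (leq_trans K0 nK) _ _ hDk hz.
    rewrite (w0 _ nK) (F0 hD) mulr0 ge_min leNgt ltr01 /= => Fz.
    have -> : z = 0 by apply: (F_eq0 hD); apply/eqP; rewrite eq_le Fz (ds_ge0 hD).
    by rewrite normr0 ltW.
have [g' [g'D g'0 g'g g'sum]] := modified_dislocations winf.
have [B hB] := profile_sum_bounded.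
have geom n : \sum_(0 <= i < n) (2^-1 ^+ i : R) <= 2.
  suff -> : \sum_(0 <= i < n) (2^-1 ^+ i : R) = 2 - 2 * 2^-1 ^+ n.
    by rewrite gerBl mulr_ge0// exprn_ge0// invr_ge0.
  elim: n => [|n IH]; first by rewrite big_geq// expr0 mulr1 subrr.
  by rewrite big_nat_recr//= IH exprS; field.
have tails := nneg_series_tail (fun i => F (w i) + 2^-1 ^+ i) (B + 2) _ _.
have {}tails : forall e : R, 0 < e -> exists m0, forall m n, (m0 <= m)%N ->
    \sum_(m <= i < n) (F (w i) + 2^-1 ^+ i) <= e.
  apply: tails => [i|n]; first by rewrite addr_ge0 ?(ds_ge0 hD)// exprn_ge0// invr_ge0.
  by rewrite big_split /= lerD// hB.
have sumF k m n : F (\sum_(m <= i < n) g' i k (w i)) <= \sum_(m <= i < n) (F (w i) + 2^-1 ^+ i).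
  elim: n => [|n IH]; first by rewrite !big_geq// (F0 hD).
  have [mn|nm] := leqP m n; last by rewrite !big_geq// (F0 hD).
  by apply: le_trans (g'sum k m n mn) _; rewrite [leRHS]big_nat_recr//= addrA !lerD2r.
exists g'; split => //.
- move=> e e0; have [d d0 hd] := F_coercive winf e e0.
  have d2 : 0 < d / 2 by rewrite divr_gt0.
  have [m0 hm0] := tails _ d2; exists m0 => m n k mm; apply: hd.
  apply: le_lt_trans (sumF k m n) _; apply: le_lt_trans (hm0 m n mm) _.
  by rewrite ltr_pdivrMr// ltr_pMr// ltr1n.
- move=> e m0 e0; have [d d0 hd] := F_coercive winf e e0.
  have d4 : 0 < Num.min 1 d / 4 by rewrite divr_gt0// lt_min ltr01.
  have [m1 hm1] := tails _ d4; pose n := (maxn m0 m1).+1.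
  exists n => [|h z hDk hz]; first by rewrite /n leqW// leq_maxl.
  apply: hd; have := ps_max gw n isT h z hDk hz.
  have : F (w n) <= Num.min 1 d / 4.
    have := hm1 n n.+1; rewrite /n leqW ?leq_maxr// => /(_ isT); rewrite -/n big_nat1.
    apply: le_trans; rewrite lerDl exprn_ge0// invr_ge0//.
  move=> h1 h2; rewrite ltNge; apply/negP => dz.
  have : Num.min 1 d <= Num.min 1 (F z) by rewrite le_min !ge_min lexx dz orbT.
  have : 0 < Num.min 1 d by rewrite lt_min ltr01.
  lra.
Qed.

End UniformConvergence.

(** * The remainder converges D-weakly to zero *)

Section Remainder.
Context {R : realType} {X : completeNormedModType R}.
Context {F : X -> R} {D : set (X -> X)} (hD : dislocation_space F D).
Context {U : set_system nat} {UU : UltraFilter U}.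

Let UP : ProperFilter U := ultra_proper.
Local Existing Instance UP.

Lemma tail_sum_cvg (a : nat -> X) (m : nat) : cvgn (series a) ->
  \sum_(m <= i < n) a i @[n --> \oo] --> limn (series a) - series a m.
Proof.
move=> ca; apply: cvg_trans (cvgB ca (cvg_cst (series a m))).
apply: near_eq_cvg; exists m => // n /= mn.
rewrite /series/= !fctE (big_cat_nat (n := m) (p := n))//=.
by rewrite addrAC subrr add0r.
Qed.

Context {u : nat -> X} {C : R} (uC : forall k, `|u k| <= C).
Context {g g' : nat -> nat -> X -> X} {w : nat -> X}.
Hypothesis gD : forall n k, D (g n k).
Hypothesis g'D : forall n k, D (g' n k).
Hypothesis g'g : forall n, \forall k \near U, g' n k = g n k.
Hypothesis g'unif : forall e : R, 0 < e -> exists m0, forall m n k, (m0 <= m)%N ->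
  `|\sum_(m <= i < n) g' i k (w i)| <= e.
Hypothesis w_small : forall (e : R) (m0 : nat), 0 < e -> exists2 n, (m0 <= n)%N &
  forall (h : nat -> X -> X) (z : X), (forall k, D (h k)) ->
    wcvg_along U (fun k => h k (remainder u g w n k)) z -> `|z| <= e.

Let a k i : X := g' i k (w i).

Lemma profile_series_cvg k : cvgn (series (a k)).
Proof.
apply: cauchy_cvg; apply/cauchy_seriesP => e e0.
have e2 : 0 < e / 2 by rewrite divr_gt0.
have [m0 hm0] := g'unif _ e2.
exists ([set n | (m0 <= n)%N], [set n | (m0 <= n)%N]).
  by split; exists m0.
move=> [m n] [/= m0m m0n]; apply: le_lt_trans (hm0 m n k m0m) _.
by rewrite ltr_pdivrMr// ltr_pMr// ltr1n.
Qed.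

Lemma profile_tail_le (e : R) : 0 < e -> exists m0, forall m k, (m0 <= m)%N ->
  `|limn (series (a k)) - series (a k) m| <= e.
Proof.
move=> e0; have [m0 hm0] := g'unif _ e0; exists m0 => m k mm.
have c : `|\sum_(m <= i < n) a k i| @[n --> \oo] --> `|limn (series (a k)) - series (a k) m|.
  by apply: cvg_norm; apply: tail_sum_cvg; exact: profile_series_cvg.
by apply: (cvgr_to_le c); apply: nearW => n; exact: hm0.
Qed.

(** D-weak convergence, stated without sequences of dislocations so that it
    passes to subsequences. Otherwise some dislocated weak limit [z] of a late
    remainder would have [f z] bounded away from zero, although [z] is small. *)
Lemma remainder_Dnull (f : X -> R^o) (e : R) : dual_space f -> 0 < e ->
  U [set k | forall h, D h -> `|f (h (u k - limn (series (a k))))| <= e].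
Proof.
move=> fD e0; set A := [set k | _].
have [//|UA] := in_ultra_setVsetC A UU; exfalso.
have [K K0 hK] := dual_bounded fD.
have [h hh] : exists h : nat -> X -> X, (forall k, D (h k)) /\
    forall k, ~ A k -> e < `|f (h k (u k - limn (series (a k))))|.
  have /choice[h hh] : forall k, exists h, D h /\
      (~ A k -> e < `|f (h (u k - limn (series (a k))))|).
    move=> k; have [Ak|/existsNP[h /not_implyP[hDh /negP]]] := pselect (A k).
      by exists idfun; split => //; exact: (ds_id hD).
    by rewrite -ltNge => lt; exists h.
  by exists h; split => k; have [] := hh k.
case: hh => hDk hlt.
have e4 : 0 < e / 4 by rewrite divr_gt0.
have eK : 0 < e / 4 / K by rewrite divr_gt0.
have [m0 hm0] := profile_tail_le _ eK.
have [n mn hn] := w_small _ m0 eK.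
have [z hz] : exists z, wcvg_along U (fun k => h k (remainder u g w n k)) z.
  apply: (ultra_weak_limit (ds_reflexive hD) _ (C + \sum_(0 <= i < n) `|w i|)) => k.
  rewrite (D_norm hD)//; apply: le_trans (ler_normB _ _) _.
  apply: lerD => //; apply: le_trans (ler_norm_sum _ _ _) _.
  by apply: ler_sum => i _; rewrite (D_norm hD).
have fz : `|f z| <= e / 4.
  apply: le_trans (hK _) _; rewrite mulrC -ler_pdivlMr//; exact: hn hz.
have agree : \forall k \near U, forall i : 'I_n, g' i k = g i k.
  by apply: filter_forall => i; exact: g'g.
have /cvgrPdist_le/(_ _ e4) close := hz f fD.
have [k [/= [Ak agr] cl]] := filter_ex (filterI (filterI UA agree) close).
have := hlt k Ak; apply/negP; rewrite -leNgt.
have -> : u k - limn (series (a k)) =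
    remainder u g w n k - (limn (series (a k)) - series (a k) n).
  rewrite /remainder opprB addrA; congr (_ - _).
  rewrite -addrA -[LHS]addr0; congr (_ + _); rewrite /series /= addrC.
  apply/esym/eqP; rewrite subr_eq0; apply/eqP; rewrite !big_mkord.
  by apply: eq_bigr => i _; rewrite /a agr.
rewrite (DB hD)// dualB//; apply: le_trans (ler_normB _ _) _.
have h1 : `|f (h k (limn (series (a k)) - series (a k) n))| <= e / 4.
  by apply: le_trans (hK _) _; rewrite (D_norm hD)// mulrC -ler_pdivlMr//; exact: hm0.
have h2 : `|f (h k (remainder u g w n k))| <= e / 4 + e / 4.
  rewrite -[f (h k _)](subKr (f z)); apply: le_trans (ler_normB _ _) _.
  exact: lerD.
lra.
Qed.

End Remainder.

(** * Assembling the decomposition *)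

Section Assembly.
Context {R : realType} {X : completeNormedModType R}.

(** The profiles are numbered from 0 in the proof and from 1 in the theorem. *)
Lemma shifted_profile_psum (P : pred nat) (a : nat -> X) (m N : nat) :
  (forall i, ~~ P i -> a i = 0) ->
  \sum_(m <= n < N | n \in [set n | (1 <= n)%N /\ P n.-1]) a n.-1 =
  \sum_(m.-1 <= i < N.-1) a i.
Proof.
move=> aP.
have key m' : \sum_(m'.+1 <= n < N | n \in [set n | (1 <= n)%N /\ P n.-1]) a n.-1 =
    \sum_(m' <= i < N.-1) a i.
  rewrite big_add1 big_mkcond /=; apply: eq_bigr => i _.
  by case: ifPn => //; rewrite notin_setE /= => h; apply/esym/aP/negP => Pi; apply: h.
case: m => [|m]; last exact: key.
rewrite /= -key; case: N {key} => [|N]; first by rewrite !big_geq.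
rewrite big_ltn_cond// ifF//.
by apply/negbTE; rewrite notin_setE /= => -[].
Qed.

End Assembly.

Theorem theorem2p6 (R : realType) (X : completeNormedModType R)
    (F : X -> R) (D : set (X -> X)) (hD : dislocation_space F D)
    (u : nat -> X) (hu : bounded_fun u) :
  exists (N0 : set nat) (w : nat -> X) (g : nat -> nat -> X -> X),
    [/\ N0 `<=` [set n | (1 <= n)%N],
        forall n, N0 n -> forall k, D (g n k),
        N0 1%N -> forall k, g 1%N k = idfun,
        forall m n, N0 m -> N0 n -> m <> n ->
          op_wcvg0 (fun k => opinv (g m k) \o g n k) &
        exists2 phi : nat -> nat, increasing_seq phi &
          let v := fun k => u (phi k) in
          [/\ forall n, N0 n -> wcvg (fun k => opinv (g n k) (v k)) (w n),
              (\esum_(n in N0) (F (w n))%:E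
                 <= limn_esup (fun k => (F (v k))%:E))%E,
              forall k, cvgn (profile_psum N0 w g 0 k),
              Dwcvg D (fun k => v k - profile_tail N0 w g 0 k) 0 &
              (fun m => ereal_sup
                 (range (fun k => (F (profile_tail N0 w g m k))%:E)))
                @ \oo --> 0%E]].
Proof.
have [C uC] : exists C, forall k, `|u k| <= C.
  by case: hu => M [_ hM]; exists (M + 1) => k; apply: (hM (M + 1)) => //; rewrite ltrDl.
have [U [UU Uoo]] := ultra_above_eventually.
have UP : ProperFilter U := ultra_proper.
have [g [w gw]] := profile_system_exists hD Uoo u C uC.
have [g' [g'D g'0 g'g g'unif w_small]] := uniform_profiles hD Uoo uC gw.
have gD := ps_D gw.
pose a k i : X := g' i k (w i).
pose T k : X := limn (series (a k)).
have cser k : cvgn (series (a k)) := profile_series_cvg g'unif k.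
have [f fD fsep] := separating_family hD.
pose P := profile_index w.
pose J := {p : nat * nat | [&& P p.1, P p.2 & p.1 != p.2]}.
(* One subsequence serves for the weak limits, the orthogonality relations and
   the countably many conditions expressing D-weak convergence. *)
have [| | | | |phi [phi_incr hlim horth hnull]] := @ultra_subsequence_weak R X F D hD U UU Uoo
    {n | P n} J (nat * nat)%type
    (fun n k => opinv (g' (val n) k) (u k)) (fun n => w (val n))
    (fun j k => opinv (g' (val j).1 k) \o g' (val j).2 k)
    (fun p => [set k | forall h, D h -> `|f p.1 (h (u k - T k))| <= p.2.+1%:R^-1]).
- by move=> n; exists C => k; rewrite (D_norm hD)//; exact: (D_opinv hD).
- move=> [n Pn] /=; apply: near_eq_wcvg_along (ps_lim gw n Pn).
  by apply: filterS (g'g n) => k ->.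
- by move=> j k; apply: (ds_comp hD) => //; exact: (D_opinv hD).
- move=> [[m n] /and3P[Pm Pn mn]] x /=; apply: near_eq_wcvg_along (ps_orth gw m n Pm Pn mn x).
  by apply: filterS (filterI (g'g m) (g'g n)) => k [-> ->].
- by move=> [i p]; apply: (remainder_Dnull hD uC gD g'g g'unif w_small) => //=; rewrite invr_gt0.
pose N0 := [set n | (1 <= n)%N /\ P n.-1].
pose gg n k := g' n.-1 (phi k).
pose ww n := w n.-1.
have wP i : ~~ P i -> w i = 0 by rewrite /P /profile_index negb_or negbK => /andP[_ /eqP].
have psumE m k : profile_psum N0 ww gg m k = fun N => \sum_(m.-1 <= i < N.-1) a (phi k) i.
  apply/funext => N; rewrite /profile_psum.
  apply: (shifted_profile_psum P (a (phi k))) => i /wP wi.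
  by rewrite /a wi (D0 hD (g'D _ _)).
have psumcvg m k : profile_psum N0 ww gg m k @ \oo --> T (phi k) - series (a (phi k)) m.-1.
  rewrite psumE; have h := tail_sum_cvg (a (phi k)) m.-1 (cser (phi k)).
  have predoo : predn @ \oo --> \oo.
    by move=> A [N _ NA]; exists N.+1 => // -[//|n] /= Nn; exact: NA.
  exact: cvg_comp predoo h.
have tailE m k : profile_tail N0 ww gg m k = T (phi k) - series (a (phi k)) m.-1.
  by apply: cvg_lim; [exact: norm_hausdorff | exact: psumcvg].
have tail0E k : profile_tail N0 ww gg 0 k = T (phi k).
  by rewrite tailE /series /= big_geq// subr0.
have [m0 hT] := profile_tail_le g'unif 1 ltr01.
exists N0, ww, gg; split.
- by move=> n [].
- by move=> n _ k; exact: g'D.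
- by move=> _ k; rewrite /gg g'0 (ps_id gw).
- move=> [|m] [|n] [//= _ Pm] [//= _ Pn] mn.
  have h : [&& P m, P n & m != n] by rewrite Pm Pn; apply/eqP => e; apply: mn; rewrite e.
  exact: (horth (exist _ (m, n) h)).
exists phi => //=; split.
- by move=> [|n] [//= _ Pn]; exact: (hlim (exist _ n Pn)).
(* A partial sum over genuine profiles is bounded by [ds_splitting]; the other
   profiles are zero and contribute nothing. *)
- have Fsum M : ((\sum_(n < M) F (w n))%:E <= limn_esup (fun k => (F (u (phi k)))%:E))%E.
    have ub : bounded_fun (u \o phi).
      by exists C; split=> [|r Cr k _ /=]; [exact: num_real | apply: le_trans (ltW Cr)].
    have split M' : (forall n, (n < M')%N -> P n) ->
        ((\sum_(n < M') F (w n))%:E <= limn_esup (fun k => (F (u (phi k)))%:E))%E.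
      move=> PM'; apply: le_trans (limn_einf_sup _).
      have [||//] := @ds_splitting _ _ _ _ hD M' (fun n k => g' n (phi k)) (u \o phi)
        (fun n => w n) (fun n k => g'D n _) _ ub.
        move=> m n mn; have h : [&& P m, P n & (m : nat) != n] by rewrite !PM'.
        exact: (horth (exist _ (m : nat, n : nat) h)).
      by move=> n; exact: (hlim (exist _ (n : nat) (PM' _ (ltn_ord n)))).
    elim: M => [|M IH]; first exact: split.
    have [PM|nPM] := boolP (P M); last by rewrite big_ord_recr /= wP// (F0 hD) addr0.
    apply: split => n; rewrite ltnS => nM.
    elim: M PM nM {IH} => [|M IH] PM; first by rewrite leqn0 => /eqP ->.
    rewrite leq_eqVlt => /predU1P[->//|]; rewrite ltnS; apply: IH.
    exact: (ps_prev gw).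
  have -> : N0 = [set n | (1 <= n)%N && P n.-1].
    by apply/seteqP; split => n /= => [[-> ->]|/andP[]].
  rewrite -nneseries_esum; last by move=> n _; rewrite lee_fin (ds_ge0 hD).
  apply: lime_le.
    by apply: is_cvg_nneseries_cond => n _ _; rewrite lee_fin (ds_ge0 hD).
  apply: nearW => N; apply: le_trans (Fsum N).
  rewrite sumEFin lee_fin; case: N => [|N]; first by rewrite big_geq// big_ord0.
  rewrite big_ltn_cond//= big_add1 /= big_ord_recr /= big_mkord [leLHS]big_mkcond /=.
  rewrite -[leLHS]addr0 lerD ?(ds_ge0 hD)//; apply: ler_sum => i _.
  by case: ifP => // _; exact: (ds_ge0 hD).
- by move=> k; apply/cvg_ex; eexists; exact: psumcvg.
- move=> h hDk; have rb k : `|u (phi k) - T (phi k)| <= C + (1 + \sum_(0 <= i < m0) `|w i|).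
    apply: le_trans (ler_normB _ _) _; apply: lerD => //.
    rewrite -[T _](subrK (series (a (phi k)) m0)); apply: le_trans (ler_normD _ _) _.
    apply: lerD; first exact: hT.
    apply: le_trans (ler_norm_sum _ _ _) _.
    by apply: ler_sum => i _; rewrite (D_norm hD).
  apply: (wcvg_separating hD f _ _ (C + (1 + \sum_(0 <= i < m0) `|w i|))) => //.
    by move=> k; rewrite subr0 tail0E (D_norm hD).
  move=> i; rewrite (dual0 _ (fD i)); apply/cvgrPdist_le => e e0.
  have [n ne] : exists n : nat, n.+1%:R^-1 <= e.
    exists (Num.trunc e^-1); rewrite -[leRHS]invrK lef_pV2 ?posrE ?invr_gt0//.
    by apply: ltW; apply: truncnS_gt.
  apply: filterS (hnull (i, n)) => k /= hk.
  by rewrite sub0r normrN subr0 tail0E; apply: le_trans ne; exact: hk.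
- apply/fine_cvgP.
  have Fsmall (e : R) : 0 < e -> exists m1, forall m k, (m1 <= m)%N ->
      F (profile_tail N0 ww gg m k) <= e.
    move=> e0; have cF : F z @[z --> (0 : X)] --> F 0 by exact: ds_continuous hD 0.
    have : \forall z \near (0 : X), F z <= e by apply: (cvgr_le _ cF); rewrite (F0 hD).
    move=> /nbhs_ballP[d /= d0 hd].
    have d2 : 0 < d / 2 by rewrite divr_gt0.
    have [m1 hm1] := profile_tail_le g'unif _ d2.
    exists m1.+1 => m k mm; apply: hd; rewrite -ball_normE /= sub0r normrN tailE.
    apply: (@le_lt_trans _ _ (d / 2)); last by rewrite ltr_pdivrMr// ltr_pMr// ltr1n.
    by apply: hm1; rewrite -ltnS (leq_trans mm)// leqSpred.
  pose s m := ereal_sup (range (fun k => (F (profile_tail N0 ww gg m k))%:E)).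
  have s0 m : (0 <= s m)%E.
    apply: (@le_trans _ _ (F (profile_tail N0 ww gg m 0))%:E).
      by rewrite lee_fin (ds_ge0 hD).
    by apply: ereal_sup_ubound; exists 0%N.
  have ssmall (e : R) : 0 < e -> \forall m \near \oo, (s m <= e%:E)%E.
    move=> e0; have [m1 hm1] := Fsmall e e0; exists m1 => // m /= mm.
    by apply: ge_ereal_sup => _ [k _ <-]; rewrite lee_fin; exact: hm1.
  have sfin m e : (s m <= e%:E)%E -> s m \is a fin_num.
    by move=> sm; rewrite ge0_fin_numE ?s0//; exact: le_lt_trans sm (ltry e).
  split; first by apply: filterS (ssmall 1 ltr01) => m; exact: sfin.
  apply/cvgrPdist_le => e e0; apply: filterS (ssmall e e0) => m sm.
  rewrite sub0r normrN /= ger0_norm; last by apply: fine_ge0; exact: s0.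
  by rewrite -lee_fin fineK//; exact: sfin sm.
Qed.
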